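(* The only compact Toeplitz operator on the Hardy space $H^2(S_\Omega)$ is the zero operator: if $\phi\in L^\infty(S_\Omega)$ and $T_\phi$ is compact, then $\phi=0$ almost everywhere on $S_\Omega$.
   Context: $\Omega\subset\mathbb C^d$ is a classical (irreducible) Cartan domain of rank $r$ in Harish-Chandra realization; $S_\Omega$ its Shilov boundary with the unique probability measure $dz$ invariant under the stabilizer $\mathbb K$ of $0$ in the identity component of $\mathrm{Aut}(\Omega)$. $H^2(S_\Omega)$ is the Hardy space (holomorphic $f$ on $\Omega$ with $\sup_{0<t<1}\int_{S_\Omega}|f(tz)|^2dz<\infty$, identified with the closure of polynomials in $L^2(S_\Omega,dz)$), $P_{H^2(S_\Omega)}$ the Szegő projection, and $T_\phi h=P_{H^2(S_\Omega)}(\phi h)$ for $\phi\in L^\infty(S_\Omega)$. *)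

(* Defs.v *)
From HB Require Import structures.
From mathcomp Require Import all_boot all_order all_algebra.
From mathcomp Require Import complex.
From mathcomp Require Import all_classical all_reals all_analysis.


Import Order.TTheory GRing.Theory Num.Theory.
Local Open Scope ring_scope.
Local Open Scope classical_set_scope.

(* Ambient space: complex p x q matrices, with the Borel sigma-algebra *)
(* of C^{pq} = R^{2pq} (generated by real/imaginary parts of entries). *)

Definition CMx (R : realType) (p q : nat) := 'M[R[i]]_(p, q).
HB.instance Definition _ (R : realType) p q := Choice.on (CMx R p q).
HB.instance Definition _ (R : realType) p q :=
  isPointed.Build (CMx R p q) (0 : 'M[R[i]]_(p, q)).

Definition coord_sets (R : realType) (p q : nat) : set (set (CMx R p q)) :=
  [set A | exists (i : 'I_p) (j : 'I_q) (B : set R), measurable B /\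
     (A = (fun Z : CMx R p q => complex.Re (Z i j)) @^-1` B \/
      A = (fun Z : CMx R p q => complex.Im (Z i j)) @^-1` B)].

Definition Amb (R : realType) (p q : nat) := g_sigma_algebraType (coord_sets R p q).

Definition cadj {R : realType} {p q : nat} (Z : 'M[R[i]]_(p, q)) : 'M[R[i]]_(q, p) :=
  (map_mx Num.conj Z)^T.

Definition unitary_mx {R : realType} {n : nat} (U : 'M[R[i]]_n) : Prop :=
  U *m cadj U = 1%:M.

(* The four classical (irreducible) Cartan domains, realized as        *)
(* spaces of matrices:                                                 *)
(*  I_{m,n}  : m x n matrices,  1 <= m <= n                            *)
(*  II_n     : skew-symmetric n x n matrices, n >= 2                   *)
(*  III_n    : symmetric n x n matrices, n >= 1                        *)
(*  IV_n     : the Lie ball in C^n (row vectors 1 x n), n >= 3         *)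

Inductive cartan_type : Type :=
| CartanI of nat & nat
| CartanII of nat
| CartanIII of nat
| CartanIV of nat.

Definition ct_rows (t : cartan_type) : nat :=
  match t with CartanI m _ => m | CartanII n => n | CartanIII n => n | CartanIV _ => 1 end.
Definition ct_cols (t : cartan_type) : nat :=
  match t with CartanI _ n => n | CartanII n => n | CartanIII n => n | CartanIV n => n end.

Definition classical_cartan (t : cartan_type) : Prop :=
  match t with
  | CartanI m n => (1 <= m)%N /\ (m <= n)%N
  | CartanII n => (2 <= n)%N
  | CartanIII n => (1 <= n)%N
  | CartanIV n => (3 <= n)%N
  end.

(* The Shilov boundary S_Omega (set of maximal tripotents), explicitly. *)
Definition shilov (R : realType) (t : cartan_type) :
    set 'M[R[i]]_(ct_rows t, ct_cols t) :=
  match t as t0 return set 'M[R[i]]_(ct_rows t0, ct_cols t0) with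
  | CartanI m n => [set Z | Z *m cadj Z = 1%:M]
  | CartanII n => [set Z | Z^T = - Z /\ Z *m cadj Z *m Z = Z /\
                           \rank Z = (n./2).*2]
  | CartanIII n => [set Z | Z^T = Z /\ Z *m cadj Z = 1%:M]
  | CartanIV n => [set Z | exists (u : R[i]) (x : 'rV[R]_n),
                     `|u| = 1 /\ \sum_(j < n) x 0 j ^+ 2 = 1 /\
                     Z = u *: map_mx (fun r : R => (r%:C)%C) x]
  end.

(* The group K (stabilizer of 0 in the identity component of Aut(Omega)),
   as a set of maps of the ambient space. *)
Definition Kgroup (R : realType) (t : cartan_type) :
    set ('M[R[i]]_(ct_rows t, ct_cols t) -> 'M[R[i]]_(ct_rows t, ct_cols t)) :=
  match t as t0 return
    set ('M[R[i]]_(ct_rows t0, ct_cols t0) -> 'M[R[i]]_(ct_rows t0, ct_cols t0)) with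
  | CartanI m n => [set k | exists (U : 'M[R[i]]_m) (V : 'M[R[i]]_n),
                    unitary_mx U /\ unitary_mx V /\ k = fun Z => U *m Z *m V]
  | CartanII n => [set k | exists U : 'M[R[i]]_n,
                    unitary_mx U /\ k = fun Z => U *m Z *m U^T]
  | CartanIII n => [set k | exists U : 'M[R[i]]_n,
                    unitary_mx U /\ k = fun Z => U *m Z *m U^T]
  | CartanIV n => [set k | exists (u : R[i]) (A : 'M[R]_n),
                    `|u| = 1 /\ A *m A^T = 1%:M /\ \det A = 1 /\
                    k = fun Z => u *: (Z *m map_mx (fun r : R => (r%:C)%C) A)]
  end.

Definition shilov_measure {R : realType} {t : cartan_type}
    (mu : probability (Amb R (ct_rows t) (ct_cols t)) R) : Prop :=
  (exists A : set (Amb R (ct_rows t) (ct_cols t)),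
      measurable A /\ A `<=` shilov R t /\ mu A = 1%E) /\
  (forall k, Kgroup R t k ->
     forall A : set (Amb R (ct_rows t) (ct_cols t)), measurable A ->
       mu (k @^-1` A) = mu A).

Definition cabs2 {R : realType} (z : R[i]) : R :=
  complex.Re z ^+ 2 + complex.Im z ^+ 2.

Definition cmeasurable {d : measure_display} {T : measurableType d} {R : realType}
    (f : T -> R[i]) : Prop :=
  measurable_fun setT (fun x => complex.Re (f x)) /\
  measurable_fun setT (fun x => complex.Im (f x)).

Definition dist2 {d : measure_display} {T : measurableType d} {R : realType}
    (mu : {measure set T -> \bar R}) (f g : T -> R[i]) : \bar R :=
  (\int[mu]_x (cabs2 (f x - g x))%:E)%E.

Definition L2 {d : measure_display} {T : measurableType d} {R : realType}
    (mu : {measure set T -> \bar R}) (f : T -> R[i]) : Prop :=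
  cmeasurable f /\ (dist2 mu f (fun _ => 0%R) < +oo)%E.

Definition Linfty {d : measure_display} {T : measurableType d} {R : realType}
    (mu : {measure set T -> \bar R}) (f : T -> R[i]) : Prop :=
  cmeasurable f /\ exists M : R, {ae mu, forall x, cabs2 (f x) <= M}.

Definition poly_fun {R : realType} {p q : nat} (P : 'M[R[i]]_(p, q) -> R[i]) : Prop :=
  exists (N : nat) (c : 'I_N -> R[i]) (e : 'I_N -> 'I_p -> 'I_q -> nat),
    forall Z, P Z = \sum_(k < N) c k * \prod_(i < p) \prod_(j < q) Z i j ^+ e k i j.

Definition hardy {R : realType} {p q : nat}
    (mu : {measure set (Amb R p q) -> \bar R}) (f : Amb R p q -> R[i]) : Prop :=
  L2 mu f /\ forall eps : R, 0 < eps ->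
    exists P : 'M[R[i]]_(p, q) -> R[i], poly_fun P /\ (dist2 mu f P < eps%:E)%E.

Definition orthogonal2 {d : measure_display} {T : measurableType d} {R : realType}
    (mu : {measure set T -> \bar R}) (f h : T -> R[i]) : Prop :=
  (\int[mu]_x (complex.Re (f x * Num.conj (h x)))%:E = 0)%E /\
  (\int[mu]_x (complex.Im (f x * Num.conj (h x)))%:E = 0)%E.

(* g = P_{H^2}(f) (Szego projection, an a.e.-defined class) *)
Definition szego {R : realType} {p q : nat}
    (mu : {measure set (Amb R p q) -> \bar R}) (f g : Amb R p q -> R[i]) : Prop :=
  hardy mu g /\ forall h, hardy mu h -> orthogonal2 mu (fun x => f x - g x) h.

(* T_phi h = P_{H^2}(phi h) is a compact operator on H^2: every bounded
   sequence h_n in H^2 has a subsequence along which T_phi h_n converges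
   in L^2. *)
Definition toeplitz_compact {R : realType} {p q : nat}
    (mu : {measure set (Amb R p q) -> \bar R}) (phi : Amb R p q -> R[i]) : Prop :=
  forall h g : nat -> Amb R p q -> R[i],
    (forall n, hardy mu (h n) /\ (dist2 mu (h n) (fun _ => 0%R) <= 1)%E) ->
    (forall n, szego mu (fun x => phi x * h n x) (g n)) ->
    exists (sigma : nat -> nat) (l : Amb R p q -> R[i]),
      (forall n, (sigma n < sigma n.+1)%N) /\ L2 mu l /\
      ((fun n => dist2 mu (g (sigma n)) l) @ \oo --> 0%E).

(* Main.v *)
Require Import Defs.
From HB Require Import structures.
From mathcomp Require Import all_boot all_order all_algebra.
From mathcomp Require Import complex ring lra.
From mathcomp Require Import all_classical all_reals all_analysis.
From mathcomp Require Import measurable_realfun.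

(** Polynomials restricted to the Shilov boundary carry two rigid features: the
    sum of all [`|Z i j|^2] is a constant [r], and rotations [Z |-> v ^+ 2 *: Z]
    preserve the measure, so monomials of different degrees are orthogonal.
    Let [a] be the integral of [w := phi * p * conj q] for monomials [p], [q].
    Splitting [`|f|^2] as [r^-1 * sum `|Z i j * f|^2] repeatedly gives, for each
    [n], a monomial [f] of degree [n] whose [`|f|^2]-weighted average of [w] has
    modulus at least that of [a].  The normalised functions [f * p] are bounded in
    the Hardy space, while the normalised [f * q] are eventually orthogonal to
    every polynomial; compactness of the Toeplitz operator then forces [a = 0].

    So [phi] is orthogonal to all polynomials in [Z] and its conjugate.  The sets
    [E] such that multiplication by the indicator of [E] preserves this
    annihilator form a sigma-algebra, which contains the half-spaces because
    [(1 - t ^+ n) ^+ (n * 2 ^ n)] converges on [[0, 1]] to the indicator of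
    [t < 1/2]; hence [phi] has zero integral on every measurable set. *)

Set Implicit Arguments.
Unset Strict Implicit.
Unset Printing Implicit Defensive.
Import Order.TTheory GRing.Theory Num.Theory.
Import numFieldNormedType.Exports.
Local Open Scope ring_scope.
Local Open Scope classical_set_scope.

(** * Completeness of real L2 through almost everywhere limits *)

Section RieszFischer.
Context d (T : measurableType d) (R : realType) (mu : {measure set T -> \bar R}).

Lemma limn_einf_le_cst (v : (\bar R)^nat) (c : \bar R) :
  (forall n, v n <= c)%E -> (limn_einf v <= c)%E.
Proof.
move=> vc; rewrite limn_einf_lim; apply: lime_le; first exact: is_cvg_einfs.
near=> n; apply: le_trans (vc n); apply: ereal_inf_lbound.
by exists n => /=.
Unshelve. all: by end_near. Qed.

(** The increments are at most [Num.sqrt C * 2^-1 ^+ n] in modulus, so the telescoping series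
    converges absolutely by comparison with a geometric one. *)
Lemma is_cvg_fast_cauchy (u : R^nat) (C : R) :
  (forall n, 4 ^+ n * (u n.+1 - u n) ^+ 2 <= C) -> cvgn u.
Proof.
move=> uC; have C0 : 0 <= C by apply: le_trans (uC 0%N); rewrite mulr_ge0 ?sqr_ge0.
have -> : u = (fun n => u 0%N + series (telescope u) n).
  by apply/funext => n; exact: eq_sum_telescope.
apply: is_cvgD; first exact: is_cvg_cst.
apply: (@normed_cvg R R^o).
apply: (@series_le_cvg _ _ (geometric (Num.sqrt C) 2^-1)).
- by move=> n; exact: normr_ge0.
- by move=> n; rewrite /geometric /= mulr_ge0 ?sqrtr_ge0.
- move=> n; rewrite /geometric /= /telescope.
  rewrite -(@ler_pXn2r _ 2) ?nnegrE ?mulr_ge0 ?sqrtr_ge0// exprMn sqr_sqrtr//.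
  rewrite exprAC [2^-1 ^+ 2]exprVn -[X in X <= _](real_normK (num_real _)) normr_id.
  rewrite real_normK ?num_real//.
  have -> : (2 ^+ 2 : R) = 4 by rewrite -natrX.
  by rewrite exprVn ler_pdivlMr ?exprn_gt0// mulrC; exact: uC.
- by apply: is_cvg_geometric_series; rewrite ger0_norm// invf_lt1// ltr1n.
Qed.

(** The rate [8^-1 ^+ n] leaves room for the weight [4 ^+ n]: the weighted squared increments have
    integrals at most [2^-1 ^+ n], so their sum is finite almost everywhere and [u] converges there.
    Fatou's lemma passes the bound to the limit. *)
Lemma riesz_fischer (u : nat -> T -> R) :
  (forall n, measurable_fun setT (u n)) ->
  (forall n m, (n <= m)%N ->
    \int[mu]_x ((u m x - u n x) ^+ 2)%:E <= (8^-1 ^+ n)%:E)%E ->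
  exists2 l : T -> R, measurable_fun setT l &
    forall n, (\int[mu]_x ((l x - u n x) ^+ 2)%:E <= (8^-1 ^+ n)%:E)%E.
Proof.
move=> mu_ uC.
pose D n x : \bar R := (4 ^+ n * (u n.+1 x - u n x) ^+ 2)%:E.
have D0 n x : (0 <= D n x)%E by rewrite lee_fin mulr_ge0 ?sqr_ge0.
have mD n : measurable_fun setT (D n).
  apply/measurable_EFinP; apply: measurable_funM => //.
  by apply: measurable_funX; exact: measurable_funB.
have mS : measurable_fun setT (fun x => \sum_(n <oo) D n x)%E.
  by apply: ge0_emeasurable_sum => // n x _ _; exact: D0.
have iS : mu.-integrable setT (fun x => \sum_(n <oo) D n x)%E.
  apply/integrableP; split => //.
  under eq_integral do rewrite gee0_abs ?nneseries_ge0//.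
  rewrite integral_nneseries//.
  apply: (@le_lt_trans _ _ (2%:E)); last exact: ltry.
  apply: lime_le; first by apply: is_cvg_nneseries => n _ _; exact: integral_ge0.
  near=> n.
  apply: (@le_trans _ _ (\sum_(0 <= i < n) (2^-1 ^+ i)%:E)%E).
    apply: lee_sum => i _.
    under eq_integral do rewrite /D EFinM.
    rewrite ge0_integralZl//; last 2 first.
    - by apply/measurable_EFinP; apply: measurable_funX; exact: measurable_funB.
    - by move=> x _; rewrite lee_fin sqr_ge0.
    have -> : (2^-1 ^+ i : R) = 4 ^+ i * 8^-1 ^+ i.
      by rewrite -exprMn; congr (_ ^+ _); field.
    by rewrite EFinM; apply: lee_wpmul2l; [rewrite lee_fin|exact: uC].
  rewrite sumEFin lee_fin.
  elim: (n) => [|m IH]; first by rewrite big_nil.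
  have -> : \sum_(0 <= i < m.+1) 2^-1 ^+ i = 1 + 2^-1 * \sum_(0 <= i < m) 2^-1 ^+ i :> R.
    rewrite big_nat_recl// expr0 big_distrr /=; congr (_ + _).
    by apply: eq_bigr => i _; rewrite exprS.
  by lra.
have ucv : {ae mu, forall x, cvgn (u ^~ x)}.
  have := integrable_ae measurableT iS; apply: filterS => x /(_ I) fx.
  apply: (@is_cvg_fast_cauchy _ (fine (\sum_(n <oo) D n x)%E)) => n.
  rewrite -lee_fin fineK//.
  have := @nneseries_lim_ge R (D ^~ x) xpredT 0%N n.+1 (fun n _ _ => D0 n x).
  apply: le_trans; rewrite big_nat_recr//=.
  by rewrite leeDr// sume_ge0.
(* A limsup is measurable whether or not [u] converges, and it is the limit wherever [u] does. *)
pose l x := fine (limn_esup (fun n => (u n x)%:E)).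
have ml : measurable_fun setT l.
  apply: measurableT_comp => //; apply: measurable_fun_limn_esup => n.
  exact/measurable_EFinP.
exists l => // n.
(* The shift by [n] makes the Cauchy bound of index [n] hold for every [m], hence for the liminf in
   Fatou's lemma. *)
pose f m x : \bar R := ((u (m + n)%N x - u n x) ^+ 2)%:E.
have mf m : measurable_fun setT (f m).
  by apply/measurable_EFinP; apply: measurable_funX; exact: measurable_funB.
apply: (@le_trans _ _ (limn_einf (fun m => \int[mu]_x f m x)%E)); last first.
  by apply: limn_einf_le_cst => m; apply: uC; rewrite leq_addl.
apply: le_trans (fatou _ measurableT mf _); last by move=> m x _; rewrite lee_fin sqr_ge0.
apply: ae_ge0_le_integral => //.
- by move=> x _; rewrite lee_fin sqr_ge0.
- by apply/measurable_EFinP; apply: measurable_funX; exact: measurable_funB.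
- move=> x _; rewrite limn_einf_lim; apply: lime_ge; first exact: is_cvg_einfs.
  by near=> k; apply: le_ereal_inf_tmp => _ [j _ <-]; rewrite lee_fin sqr_ge0.
- have -> : (fun x => limn_einf (f ^~ x)) =
            (fun x => - limn_esup (fun m => - f m x))%E.
    by apply/funext => x; rewrite -[LHS]oppeK -limn_esupN.
  apply: measurableT_comp => //; apply: measurable_fun_limn_esup => m.
  exact: measurableT_comp.
apply: filterS ucv => x cu _.
have cE : (fun k => (u k x)%:E) @ \oo --> (limn (u ^~ x))%:E by apply: cvg_EFin => //; exact: nearW.
rewrite /l (cvg_limn_einf_sup cE).2 /=.
suff cf : f ^~ x @ \oo --> ((limn (u ^~ x) - u n x) ^+ 2)%:E by rewrite (cvg_limn_einf_sup cf).1.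
apply: cvg_EFin; first exact: nearW.
apply: (@cvg_comp _ _ _ _ (fun y : R => y ^+ 2)); last exact: exprn_continuous.
apply: cvgB; last exact: cvg_cst.
by rewrite /= (cvg_shiftn n (u ^~ x)).
Unshelve. all: by end_near. Qed.

End RieszFischer.

(** * Real and imaginary parts, squared modulus *)

Section ComplexParts.
Context (R : realType).
Implicit Types a b : R[i].

Lemma ReD a b : complex.Re (a + b) = complex.Re a + complex.Re b.
Proof. by case: a; case: b. Qed.

Lemma ImD a b : complex.Im (a + b) = complex.Im a + complex.Im b.
Proof. by case: a; case: b. Qed.

Lemma ReN a : complex.Re (- a) = - complex.Re a.
Proof. by case: a. Qed.

Lemma ImN a : complex.Im (- a) = - complex.Im a.
Proof. by case: a. Qed.

Lemma ReM a b : complex.Re (a * b) =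
  complex.Re a * complex.Re b - complex.Im a * complex.Im b.
Proof. by case: a; case: b. Qed.

Lemma ImM a b : complex.Im (a * b) =
  complex.Re a * complex.Im b + complex.Im a * complex.Re b.
Proof. by case: a => ? ?; case: b => ? ? /=; rewrite addrC. Qed.

Lemma ReJ a : complex.Re (Num.conj a) = complex.Re a.
Proof. by case: a. Qed.

Lemma ImJ a : complex.Im (Num.conj a) = - complex.Im a.
Proof. by case: a. Qed.

Definition reimE := (ReD, ImD, ReN, ImN, ReM, ImM, ReJ, ImJ).

Lemma cabs2_ge0 a : 0 <= cabs2 a.
Proof. by rewrite addr_ge0 ?sqr_ge0. Qed.

Lemma cabs2M a b : cabs2 (a * b) = cabs2 a * cabs2 b.
Proof. by rewrite /cabs2 !reimE; ring. Qed.

Lemma cabs2J a : cabs2 (Num.conj a) = cabs2 a.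
Proof. by rewrite /cabs2 !reimE sqrrN. Qed.

Lemma cabs2D_le a b : cabs2 (a + b) <= 2 * cabs2 a + 2 * cabs2 b.
Proof.
rewrite /cabs2 !reimE.
have := sqr_ge0 (complex.Re a - complex.Re b).
have := sqr_ge0 (complex.Im a - complex.Im b).
nra.
Qed.

Lemma cabs2_real (r : R) : cabs2 (r%:C)%C = r ^+ 2.
Proof. by rewrite /cabs2 /= expr0n addr0. Qed.

Lemma mulcJ (z : R[i]) : z * Num.conj z = ((cabs2 z)%:C)%C.
Proof.
by apply/eqP; rewrite eq_complex !reimE /cabs2 /=; apply/andP; split; apply/eqP; ring.
Qed.

Lemma complex_eq0P a : complex.Re a = 0 -> complex.Im a = 0 -> a = 0.
Proof. by case: a => ? ? /= -> ->. Qed.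

(** Evaluate at the minimiser [b / c]. If [c = 0] the expression is affine in [t], and a nonzero [b]
    would make it negative at [(a + 1) / b]. *)
Lemma discriminant_le (a b c : R) : 0 <= c ->
  (forall t, 0 <= a - 2 * t * b + t ^+ 2 * c) -> b ^+ 2 <= a * c.
Proof.
rewrite le_eqVlt => /predU1P[<-|c0] H.
  rewrite mulr0; have [->|b0] := eqVneq b 0; first by rewrite expr0n.
  have := H ((a + 1) / b).
  have -> : 2 * ((a + 1) / b) * b = 2 * (a + 1) by field.
  by have := H 0; rewrite !mulr0 mul0r; lra.
have := H (b / c).
have -> : a - 2 * (b / c) * b + (b / c) ^+ 2 * c = (a * c - b ^+ 2) / c.
  by field; rewrite gt_eqF.
by rewrite pmulr_lge0 ?invr_gt0// subr_ge0.
Qed.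

End ComplexParts.

(** * Complex L2 as a real inner product space *)

Section L2Space.
Context d (T : measurableType d) (R : realType) (mu : probability T R).
Implicit Types f g h : T -> R[i].

Lemma cmeasurable_cst (c : R[i]) : cmeasurable (fun _ : T => c).
Proof. by split; exact: measurable_cst. Qed.

Lemma cmeasurableD f g :
  cmeasurable f -> cmeasurable g -> cmeasurable (fun x => f x + g x).
Proof.
move=> [f1 f2] [g1 g2]; split.
  rewrite (funext (fun x => ReD (f x) (g x))); exact: measurable_funD.
rewrite (funext (fun x => ImD (f x) (g x))); exact: measurable_funD.
Qed.

Lemma cmeasurableM f g :
  cmeasurable f -> cmeasurable g -> cmeasurable (fun x => f x * g x).
Proof.
move=> [f1 f2] [g1 g2]; split.
  rewrite (funext (fun x => ReM (f x) (g x))).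
  by apply: measurable_funB; exact: measurable_funM.
rewrite (funext (fun x => ImM (f x) (g x))).
by apply: measurable_funD; exact: measurable_funM.
Qed.

Lemma cmeasurableJ f : cmeasurable f -> cmeasurable (fun x => Num.conj (f x)).
Proof.
move=> [f1 f2]; split; first by rewrite (funext (fun x => ReJ (f x))).
by rewrite (funext (fun x => ImJ (f x))); exact: measurableT_comp.
Qed.

Lemma measurable_cabs2 f : cmeasurable f -> measurable_fun setT (fun x => cabs2 (f x)).
Proof. by move=> [f1 f2]; apply: measurable_funD; exact: measurable_funX. Qed.

Lemma ae_dominated_integrable (f g : T -> R) : measurable_fun setT f ->
  mu.-integrable setT (EFin \o g) -> {ae mu, forall x, `|f x| <= g x} ->
  mu.-integrable setT (EFin \o f).
Proof.
move=> mf /integrableP[mg ig] fg; apply/integrableP; split.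
  exact/measurable_EFinP.
apply: le_lt_trans ig; apply: ae_ge0_le_integral => //.
- by apply: measurableT_comp => //; exact/measurable_EFinP.
- exact: measurableT_comp.
- apply: filterS fg => x fgx _ /=; rewrite lee_fin.
  exact: le_trans (ler_norm _).
Qed.

Lemma integrable_cst (M : R) : mu.-integrable setT (EFin \o (fun=> M)).
Proof. by apply: finite_measure_integrable_cst. Qed.

Lemma ae_eq_Rintegral (f g : T -> R) :
  measurable_fun setT f -> measurable_fun setT g -> {ae mu, forall x, f x = g x} ->
  (\int[mu]_x f x = \int[mu]_x g x)%R.
Proof.
move=> mf mg fg; congr fine; apply: ae_eq_integral => //; try exact/measurable_EFinP.
by apply: filterS fg => x -> _.
Qed.

Lemma EFin_Rintegral (f : T -> R) : mu.-integrable setT (EFin \o f) ->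
  (\int[mu]_x (f x)%:E)%E = (\int[mu]_x f x)%R%:E.
Proof. by move=> fi; rewrite /Rintegral fineK//; exact: integrable_fin_num. Qed.

Lemma L2P f : L2 mu f <->
  cmeasurable f /\ mu.-integrable setT (EFin \o (fun x => cabs2 (f x))).
Proof.
have E : (\int[mu]_x `|(EFin \o (fun x => cabs2 (f x))) x|)%E = dist2 mu f (fun=> 0).
  by apply: eq_integral => x _ /=; rewrite ger0_norm ?cabs2_ge0// subr0.
rewrite /L2 -E; split=> -[mf fi]; split => //; last by case/integrableP: fi.
by apply/integrableP; split => //; exact/measurable_EFinP/measurable_cabs2.
Qed.

Lemma L2D f g : L2 mu f -> L2 mu g -> L2 mu (fun x => f x + g x).
Proof.
move=> /L2P[mf fi] /L2P[mg gi]; apply/L2P; split; first exact: cmeasurableD.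
apply: (@ae_dominated_integrable _ (fun x => 2 * cabs2 (f x) + 2 * cabs2 (g x))).
- by apply: measurable_cabs2; exact: cmeasurableD.
- have := integrableD measurableT (integrableZl measurableT 2 fi) (integrableZl measurableT 2 gi).
  by apply: eq_integrable.
- by apply: aeW => x; rewrite ger0_norm ?cabs2_ge0// cabs2D_le.
Qed.

Lemma L2_LinftyM (b f : T -> R[i]) : Linfty mu b -> L2 mu f -> L2 mu (fun x => b x * f x).
Proof.
move=> [mb [M bM]] /L2P[mf fi]; apply/L2P; split; first exact: cmeasurableM.
apply: (@ae_dominated_integrable _ (fun x => M * cabs2 (f x))).
- by apply: measurable_cabs2; exact: cmeasurableM.
- by have := integrableZl measurableT M fi; apply: eq_integrable.
- apply: filterS bM => x bM; rewrite ger0_norm ?cabs2_ge0// cabs2M.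
  by rewrite ler_wpM2r ?cabs2_ge0.
Qed.

Lemma Linfty_cst (c : R[i]) : Linfty mu (fun=> c).
Proof.
by split; [exact: cmeasurable_cst|exists (cabs2 c); exact: aeW].
Qed.

Lemma LinftyM f g : Linfty mu f -> Linfty mu g -> Linfty mu (fun x => f x * g x).
Proof.
move=> [mf [M fM]] [mg [N gN]]; split; first exact: cmeasurableM.
exists (M * N); apply: filterS2 fM gN => x fM gN.
by rewrite cabs2M ler_pM ?cabs2_ge0.
Qed.

Lemma LinftyD f g : Linfty mu f -> Linfty mu g -> Linfty mu (fun x => f x + g x).
Proof.
move=> [mf [M fM]] [mg [N gN]]; split; first exact: cmeasurableD.
exists (2 * M + 2 * N); apply: filterS2 fM gN => x fM gN.
by apply: le_trans (cabs2D_le _ _) _; rewrite lerD// ler_pM2l.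
Qed.

Lemma LinftyJ f : Linfty mu f -> Linfty mu (fun x => Num.conj (f x)).
Proof.
move=> [mf [M fM]]; split; first exact: cmeasurableJ.
by exists M; apply: filterS fM => x; rewrite cabs2J.
Qed.

Lemma Linfty_L2 f : Linfty mu f -> L2 mu f.
Proof.
move=> [mf [M fM]]; apply/L2P; split => //.
apply: (@ae_dominated_integrable _ (fun=> M)); first exact: measurable_cabs2.
  exact: integrable_cst.
by apply: filterS fM => x; rewrite ger0_norm ?cabs2_ge0.
Qed.

Lemma Linfty_Re f : Linfty mu f -> measurable_fun setT (fun x => complex.Re (f x)) /\
  exists M, {ae mu, forall x, `|complex.Re (f x)| <= M}.
Proof.
(* [M] bounds the squared modulus, and y^2 <= M implies y <= M + 1. *)
move=> [[mf _] [M fM]]; split => //; exists (M + 1).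
apply: filterS fM => x; rewrite /cabs2 -[complex.Re _ ^+ 2](real_normK (num_real _)).
move: (`|complex.Re _|) (sqr_ge0 (complex.Im (f x))) => y im0 yM.
by have := sqr_ge0 (y - 1); nra.
Qed.

Lemma L2Z (c : R[i]) f : L2 mu f -> L2 mu (fun x => c * f x).
Proof. exact: L2_LinftyM (Linfty_cst c). Qed.

Lemma L2B f g : L2 mu f -> L2 mu g -> L2 mu (fun x => f x - g x).
Proof.
move=> fL gL; have := L2D fL (L2Z (-1) gL).
by under eq_fun do rewrite mulN1r.
Qed.

(** The real part of the Hermitian product keeps all integrals real; complex orthogonality is
    recovered in [ip_orthogonal2] by testing against i h as well as h. *)
Definition rdot f g (x : T) : R :=
  complex.Re (f x) * complex.Re (g x) + complex.Im (f x) * complex.Im (g x).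

Definition ip f g : R := (\int[mu]_x rdot f g x)%R.

Lemma rdotE f g x : rdot f g x = complex.Re (f x * Num.conj (g x)).
Proof. by rewrite /rdot !reimE; ring. Qed.

Lemma integrable_rdot f g : L2 mu f -> L2 mu g -> mu.-integrable setT (EFin \o rdot f g).
Proof.
move=> /L2P[mf fi] /L2P[mg gi].
apply: (@ae_dominated_integrable _ (fun x => cabs2 (f x) + cabs2 (g x))).
- move: mf mg => [? ?] [? ?].
  by apply: measurable_funD; exact: measurable_funM.
- by have := integrableD measurableT fi gi; apply: eq_integrable.
- apply: aeW => x; rewrite /rdot /cabs2 ler_norml.
  move: (complex.Re (f x)) (complex.Im (f x)) (complex.Re (g x)) (complex.Im (g x)) => a b c e.
  have := sqr_ge0 (a - c); have := sqr_ge0 (a + c).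
  have := sqr_ge0 (b - e); have := sqr_ge0 (b + e).
  by have := sqr_ge0 a; have := sqr_ge0 b; have := sqr_ge0 c; have := sqr_ge0 e; nra.
Qed.

Lemma ipC f g : ip f g = ip g f.
Proof. by apply: eq_Rintegral => x _; rewrite /rdot; ring. Qed.

Lemma ipDl f g h : L2 mu f -> L2 mu g -> L2 mu h ->
  ip (fun x => f x + g x) h = ip f h + ip g h.
Proof.
move=> fL gL hL; rewrite /ip -RintegralD//; try exact: integrable_rdot.
by apply: eq_Rintegral => x _; rewrite /rdot !reimE; ring.
Qed.

Lemma ipBl f g h : L2 mu f -> L2 mu g -> L2 mu h ->
  ip (fun x => f x - g x) h = ip f h - ip g h.
Proof.
move=> fL gL hL; rewrite /ip -RintegralB//; try exact: integrable_rdot.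
by apply: eq_Rintegral => x _; rewrite /rdot !reimE; ring.
Qed.

Lemma ipZl (r : R) f h : L2 mu f -> L2 mu h ->
  ip (fun x => (r%:C)%C * f x) h = r * ip f h.
Proof.
move=> fL hL; rewrite /ip -RintegralZl//; try exact: integrable_rdot.
by apply: eq_Rintegral => x _; rewrite /rdot !reimE /=; ring.
Qed.

Lemma ip_ge0 f : 0 <= ip f f.
Proof. by apply: Rintegral_ge0 => x _; rewrite /rdot -!expr2 addr_ge0 ?sqr_ge0. Qed.

Lemma dist2E f g : L2 mu f -> L2 mu g ->
  dist2 mu f g = (ip (fun x => f x - g x) (fun x => f x - g x))%:E.
Proof.
move=> fL gL; have [_ h] := (L2P _).1 (L2B fL gL).
by rewrite /dist2 EFin_Rintegral.
Qed.

Lemma ip_subE (t : R) f g : L2 mu f -> L2 mu g ->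
  ip (fun x => f x - (t%:C)%C * g x) (fun x => f x - (t%:C)%C * g x) =
  ip f f - 2 * t * ip f g + t ^+ 2 * ip g g.
Proof.
move=> fL gL; have tg := L2Z (t%:C)%C gL; have fg := L2B fL tg.
rewrite ipBl// ipZl// ![ip _ (fun x => f x - _)]ipC !ipBl// !ipZl// (ipC g f).
by ring.
Qed.

Lemma cauchy_schwarz f g : L2 mu f -> L2 mu g -> ip f g ^+ 2 <= ip f f * ip g g.
Proof.
by move=> fL gL; apply: discriminant_le => [|t]; rewrite -?ip_subE// ip_ge0.
Qed.

Lemma ip_normD_le f g : L2 mu f -> L2 mu g ->
  ip (fun x => f x + g x) (fun x => f x + g x) <= 2 * ip f f + 2 * ip g g.
Proof.
move=> fL gL; rewrite ipDl//; last exact: L2D.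
rewrite ![ip _ (fun x => f x + _)]ipC !ipDl// (ipC g f).
have := ip_ge0 (fun x => f x - (1%:C)%C * g x); rewrite ip_subE//.
by lra.
Qed.

(** The parallelogram law, with the nonnegative squared norm of [f + g] dropped. *)
Lemma ip_normB_le f g : L2 mu f -> L2 mu g ->
  ip (fun x => f x - g x) (fun x => f x - g x) <= 2 * ip f f + 2 * ip g g.
Proof.
move=> fL gL; have := ip_ge0 (fun x => f x - ((-1)%:C)%C * g x); rewrite ip_subE//.
have -> : (fun x => f x - g x) = (fun x => f x - (1%:C)%C * g x).
  by apply/funext => x; rewrite mul1r.
by rewrite ip_subE//; lra.
Qed.

End L2Space.

(** * Orthogonal projection onto the closure of a subspace of L2 *)

Section Projection.
Context d (T : measurableType d) (R : realType) (mu : probability T R).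
Implicit Types f g h : T -> R[i].

Lemma geometric8_lt (C eps : R) : 0 < eps -> exists n, C * 8^-1 ^+ n < eps.
Proof.
move=> eps0.
have cv : geometric C 8^-1 @ \oo --> (0 : R).
  by apply: cvg_geometric; rewrite ger0_norm// invf_lt1// ltr1n.
have [n _ /(_ n)] := cvgr_lt _ cv _ eps0.
by move=> /(_ (leqnn _)) /= h; exists n.
Qed.

Lemma le_geometric8_eq0 (a C : R) : 0 <= a -> (forall n, a <= C * 8^-1 ^+ n) -> a = 0.
Proof.
move=> a0 h; apply/eqP; rewrite eq_le a0 andbT leNgt; apply/negP => /(geometric8_lt C)[n].
by rewrite ltNge h.
Qed.

Lemma orthogonal2_ip f h : L2 mu f -> L2 mu h -> orthogonal2 mu f h -> ip mu f h = 0.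
Proof.
move=> fL hL [h1 _]; rewrite /ip /Rintegral.
have -> : (\int[mu]_x (rdot f h x)%:E =
           \int[mu]_x (complex.Re (f x * Num.conj (h x)))%:E)%E.
  by apply: eq_integral => x _; congr EFin; rewrite /rdot !reimE; ring.
by rewrite h1.
Qed.

Lemma ip_orthogonal2 f h : L2 mu f -> L2 mu h ->
  ip mu f h = 0 -> ip mu f (fun x => (Complex 0 1) * h x) = 0 -> orthogonal2 mu f h.
Proof.
move=> fL hL h1 h2; split.
  transitivity (ip mu f h)%:E; last by rewrite h1.
  rewrite /ip -EFin_Rintegral; last exact: integrable_rdot.
  by apply: eq_integral => x _; congr EFin; rewrite /rdot !reimE; ring.
transitivity (ip mu f (fun x => (Complex 0 1) * h x))%:E; last by rewrite h2.
rewrite /ip -EFin_Rintegral; last by apply: integrable_rdot => //; exact: L2Z.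
by apply: eq_integral => x _; congr EFin; rewrite /rdot !reimE /=; ring.
Qed.

(** [riesz_fischer] is applied to real and imaginary parts; the factor 2 adds their two bounds. *)
Lemma L2_complete (u : nat -> T -> R[i]) : (forall n, L2 mu (u n)) ->
  (forall n m, (n <= m)%N -> dist2 mu (u m) (u n) <= (8^-1 ^+ n)%:E)%E ->
  exists2 l, L2 mu l & forall n, (dist2 mu l (u n) <= (2 * 8^-1 ^+ n)%:E)%E.
Proof.
move=> uL uC.
have part (p : R[i] -> R) : (forall n, measurable_fun setT (fun x => p (u n x))) ->
    (forall n m x, (p (u m x) - p (u n x)) ^+ 2 <= cabs2 (u m x - u n x)) ->
    exists2 l : T -> R, measurable_fun setT l &
      forall n, (\int[mu]_x ((l x - p (u n x)) ^+ 2)%:E <= (8^-1 ^+ n)%:E)%E.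
  move=> mp ple; apply: (@riesz_fischer _ _ _ mu (fun n x => p (u n x))) => // n m nm.
  apply: le_trans (uC _ _ nm); apply: ge0_le_integral => //.
  - by move=> x _; rewrite lee_fin sqr_ge0.
  - by apply/measurable_EFinP; apply: measurable_funX; exact: measurable_funB.
  - by case/L2P: (L2B (uL m) (uL n)) => /measurable_cabs2 ? _; exact/measurable_EFinP.
  - by move=> x _; rewrite lee_fin; exact: ple.
have [l1 ml1 l1E] : exists2 l : T -> R, measurable_fun setT l &
    forall n, (\int[mu]_x ((l x - complex.Re (u n x)) ^+ 2)%:E <= (8^-1 ^+ n)%:E)%E.
  apply: part => [n|n m x]; first by have [[]] := uL n.
  by rewrite /cabs2 !reimE lerDl sqr_ge0.
have [l2 ml2 l2E] : exists2 l : T -> R, measurable_fun setT l &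
    forall n, (\int[mu]_x ((l x - complex.Im (u n x)) ^+ 2)%:E <= (8^-1 ^+ n)%:E)%E.
  apply: part => [n|n m x]; first by have [[]] := uL n.
  by rewrite /cabs2 !reimE lerDr sqr_ge0.
pose l x := Complex (l1 x) (l2 x).
have ml : cmeasurable l by [].
have lE n : (dist2 mu l (u n) <= (2 * 8^-1 ^+ n)%:E)%E.
  rewrite mulr_natl mulr2n EFinD.
  have -> : dist2 mu l (u n) = (\int[mu]_x (((l1 x - complex.Re (u n x)) ^+ 2)%:E +
      ((l2 x - complex.Im (u n x)) ^+ 2)%:E))%E.
    by apply: eq_integral => x _; rewrite /cabs2 !reimE.
  have [[mu1 mu2] _] := uL n.
  rewrite ge0_integralD//; first exact: leeD.
  - by move=> x _; rewrite lee_fin sqr_ge0.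
  - by apply/measurable_EFinP; apply: measurable_funX; exact: measurable_funB.
  - by move=> x _; rewrite lee_fin sqr_ge0.
  - by apply/measurable_EFinP; apply: measurable_funX; exact: measurable_funB.
exists l => //.
have dL : L2 mu (fun x => l x - u 0%N x).
  split.
    have := cmeasurableD ml (cmeasurableM (cmeasurable_cst _ (-1)) (uL 0%N).1).
    by under eq_fun do rewrite mulN1r.
  apply: le_lt_trans (ltry (2 * 8^-1 ^+ 0)); apply: le_trans (lE 0%N).
  by rewrite /dist2; under eq_integral do rewrite subr0.
have := L2D dL (uL 0%N).
by under eq_fun do rewrite subrK.
Qed.

Variable V : set (T -> R[i]).
Hypothesis VL2 : forall f, V f -> L2 mu f.
Hypothesis V0 : V (fun=> 0).
Hypothesis VD : forall f g, V f -> V g -> V (fun x => f x + g x).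
Hypothesis VZ : forall c f, V f -> V (fun x => c * f x).

(** For [V] the polynomial functions this unfolds to [hardy], as [szego_exists] exploits. *)
Definition L2closure f : Prop := L2 mu f /\
  forall eps : R, 0 < eps -> exists P, V P /\ (dist2 mu f P < eps%:E)%E.

Lemma L2closureZi f : L2closure f -> L2closure (fun x => (Complex 0 1) * f x).
Proof.
move=> [fL fV]; split; first exact: L2Z.
move=> eps /fV[P [PV fP]]; exists (fun x => (Complex 0 1) * P x); split; first exact: VZ.
rewrite (_ : dist2 _ _ _ = dist2 mu f P)//; apply: eq_integral => x _.
by rewrite -mulrBr cabs2M /cabs2 /= expr0n expr1n add0r mul1r.
Qed.

(** For [P] in [V] close to [h], Cauchy-Schwarz applied to [f] and [h - P] makes the product with
    [h] arbitrarily small. The imaginary part follows because the closure is stable under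
    multiplication by i. *)
Lemma L2closure_orthogonal f : L2 mu f ->
  (forall h, V h -> ip mu f h = 0) -> forall h, L2closure h -> orthogonal2 mu f h.
Proof.
move=> fL fV.
have key h : L2closure h -> ip mu f h = 0.
  move=> [hL hV]; apply/eqP; rewrite -sqrf_eq0; apply/eqP.
  apply: (@le_geometric8_eq0 _ (ip mu f f)); first exact: sqr_ge0.
  move=> n; have [|P [PV]] := hV (8^-1 ^+ n); first by rewrite exprn_gt0.
  have PL := VL2 PV; rewrite dist2E// lte_fin => hP.
  rewrite -[X in X ^+ 2]subr0 -(fV P PV) ![ip _ f _]ipC -ipBl// ipC.
  apply: le_trans (cauchy_schwarz fL (L2B hL PL)) _.
  by rewrite ler_wpM2l ?ip_ge0// ltW.
move=> h hV; apply: ip_orthogonal2 => //; [by case: hV|exact: key|].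
exact/key/L2closureZi.
Qed.

(** A sequence in [V] minimising the distance to [f] is Cauchy by the parallelogram law.
    Near-minimality at each [p n] becomes exact orthogonality at its limit [l]. *)
Lemma projection_exists f : L2 mu f ->
  exists2 g, L2closure g & forall h, L2closure h -> orthogonal2 mu (fun x => f x - g x) h.
Proof.
move=> fL.
pose N p := ip mu (fun x => f x - p x) (fun x => f x - p x).
pose E := [set N p | p in V].
have infE : has_inf E.
  split; first by exists (N (fun=> 0)), (fun=> 0).
  by exists 0 => _ [p _ <-]; exact: ip_ge0.
pose dd := inf E.
have dle p : V p -> dd <= N p by move=> pV; apply: ge_inf; [exact: infE.2|exists p].
(* The factor 1/4 makes [4 * e n] the rate that [L2_complete] expects. *)
pose e n : R := 4^-1 * 8^-1 ^+ n.
have e0 n : 0 < e n by rewrite mulr_gt0// exprn_gt0.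
have /choice[p pP] n : exists p, V p /\ N p < dd + e n.
  by have [_ [p pV <-] ltp] := inf_adherent (e0 n) infE; exists p.
have pL n : L2 mu (p n) by apply: VL2; case: (pP n).
have fpL n : L2 mu (fun x => f x - p n x) by exact: L2B.
have [l lL lE] : exists2 l, L2 mu l & forall n, (dist2 mu l (p n) <= (2 * 8^-1 ^+ n)%:E)%E.
  apply: L2_complete => // n m nm.
  (* The midpoint lies in [V], so [N q] is at least [dd]; the parallelogram law then bounds the
     squared distance from [p n] to [p m] by [2 * e n + 2 * e m]. *)
  pose q x := (2^-1%:C)%C * (p n x + p m x).
  have qV : V q by apply: VZ; apply: VD; case: (pP n); case: (pP m).
  have qL : L2 mu (fun x => f x - q x) by apply: L2B => //; exact: VL2.
  have := dle _ qV; rewrite /N => dq.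
  have par : 4 * N q = N (p n) + 2 * ip mu (fun x => f x - p n x) (fun x => f x - p m x)
                       + N (p m).
    have E1 : (fun x => (2%:C)%C * (f x - q x)) =
         (fun x => (f x - p n x) - ((-1)%:C)%C * (f x - p m x)).
      apply/funext => x; rewrite /q.
      have -> : ((-1)%:C)%C = -1 :> R[i] by rewrite rmorphN1.
      have -> : (2^-1%:C)%C = 2^-1 :> R[i] by rewrite fmorphV rmorph_nat.
      have -> : (2%:C)%C = 2 :> R[i] by rewrite rmorph_nat.
      by field.
    have := ip_subE (-1) (fpL n) (fpL m); rewrite -E1 ipZl//; last exact: L2Z.
    rewrite ipC ipZl// -/(N q) -/(N (p n)) -/(N (p m)); lra.
  rewrite dist2E// lee_fin.
  have -> : (fun x => p m x - p n x) = (fun x => (f x - p n x) - (1%:C)%C * (f x - p m x)).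
    by apply/funext => x; rewrite mul1r; ring.
  rewrite ip_subE// -/(N (p n)) -/(N (p m)).
  have [_ ] := pP n; have [_ ] := pP m; rewrite -/(N q) in dq.
  have em : e m <= e n.
    by rewrite ler_pM2l// ler_wiXn2l// invf_le1// ler1n.
  have -> : 8^-1 ^+ n = 4 * e n by rewrite /e; field.
  by lra.
exists l.
  split => // eps /(geometric8_lt 2)[n ln]; exists (p n); split; first by case: (pP n).
  exact: le_lt_trans (lE n) _.
apply: L2closure_orthogonal; first exact: L2B.
move=> h hV; have hL := VL2 hV.
apply/eqP; rewrite -sqrf_eq0; apply/eqP.
(* In (a - b)^2 <= 2 a^2 + 2 b^2 the bounds [h1] and [h2] below contribute 2 and 4. *)
apply: (@le_geometric8_eq0 _ (6 * ip mu h h)); first exact: sqr_ge0.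
move=> n.
(* Moving [p n] by a multiple of [h] stays in [V] and lowers [N] by less than [e n], so a quadratic
   in [t] with constant term [e n] is nonnegative. *)
have h1 : ip mu (fun x => f x - p n x) h ^+ 2 <= e n * ip mu h h.
  apply: discriminant_le => [|t]; first exact: ip_ge0.
  have := dle (fun x => p n x + (t%:C)%C * h x); rewrite /N.
  have -> : (fun x => f x - (p n x + (t%:C)%C * h x)) =
            (fun x => (f x - p n x) - (t%:C)%C * h x) by apply/funext => x; ring.
  rewrite ip_subE// -/(N (p n)).
  move=> /(_ (VD (pP n).1 (VZ _ hV))).
  by have [_] := pP n; lra.
have h2 : ip mu (fun x => l x - p n x) h ^+ 2 <= 2 * 8^-1 ^+ n * ip mu h h.
  apply: le_trans (cauchy_schwarz (L2B lL (pL n)) hL) _.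
  by rewrite ler_wpM2r ?ip_ge0// -lee_fin -dist2E.
have -> : ip mu (fun x => f x - l x) h =
  ip mu (fun x => f x - p n x) h - ip mu (fun x => l x - p n x) h.
  by rewrite !ipBl//; ring.
have : e n <= 8^-1 ^+ n.
  by rewrite /e ler_piMl ?exprn_ge0// invf_le1// ler1n.
have := ip_ge0 mu h; move: h1 h2; move: (ip _ _ h) (ip _ _ h) (ip _ h h) (e n) (8^-1 ^+ n).
move=> a b c e' g h1 h2 c0 eg.
have := sqr_ge0 (a + b); have : e' * c <= g * c by rewrite ler_wpM2r.
by lra.
Qed.

End Projection.

(** * Invariance, monotonicity and finite sums of integrals *)

Section IntegralTools.
Context d (T : measurableType d) (R : realType) (mu : probability T R).

Lemma integral_invariant (s : T -> T) (f : T -> \bar R) :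
  measurable_fun setT s ->
  (forall A, measurable A -> mu (s @^-1` A) = mu A) ->
  measurable_fun setT f -> mu.-integrable setT (f \o s) ->
  (\int[mu]_x f (s x) = \int[mu]_x f x)%E.
Proof.
move=> ms inv mf fi.
have := @integral_pushforward _ _ _ _ R s ms mu setT f mf fi measurableT.
rewrite preimage_setT => <-.
by apply: eq_measure_integral => A mA _; exact: inv.
Qed.

Lemma ae_le_Rintegral (f g : T -> R) :
  mu.-integrable setT (EFin \o f) -> mu.-integrable setT (EFin \o g) ->
  {ae mu, forall x, f x <= g x} -> (\int[mu]_x f x <= \int[mu]_x g x)%R.
Proof.
move=> fi gi fg; rewrite -subr_ge0 -RintegralB//.
have mfg : measurable_fun setT (fun x => g x - f x).
  by apply: measurable_funB; apply/measurable_EFinP; [move: gi|move: fi] => /integrableP[].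
rewrite (@ae_eq_Rintegral _ _ _ mu _ (fun x => `|g x - f x|)%R)//.
- exact: Rintegral_ge0.
- exact: measurableT_comp.
- by apply: filterS fg => x fgx; rewrite ger0_norm// subr_ge0.
Qed.

Lemma integrable_EFin_sum (I : Type) (s : seq I) (F : I -> T -> R) :
  (forall i, mu.-integrable setT (EFin \o F i)) ->
  mu.-integrable setT (EFin \o (fun x => \sum_(i <- s) F i x)).
Proof.
move=> Fi; elim: s => [|i s IH].
  by under eq_fun do rewrite big_nil; exact: integrable_cst.
under eq_fun do rewrite big_cons.
by have := integrableD measurableT (Fi i) IH; exact: eq_integrable.
Qed.

Lemma Rintegral_sum (I : Type) (s : seq I) (F : I -> T -> R) :
  (forall i, mu.-integrable setT (EFin \o F i)) ->
  (\int[mu]_x (\sum_(i <- s) F i x) = \sum_(i <- s) \int[mu]_x F i x)%R.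
Proof.
move=> Fi; elim: s => [|i s IH].
  rewrite big_nil; under eq_Rintegral do rewrite big_nil.
  by rewrite Rintegral_cst// mul0r.
rewrite big_cons -IH -RintegralD//; last exact: integrable_EFin_sum.
by apply: eq_Rintegral => x _; rewrite big_cons.
Qed.

End IntegralTools.

(** * Finite products and sums of bounded functions *)

Section LinftyBig.
Context d (T : measurableType d) (R : realType) (mu : probability T R).

Lemma Linfty_prod (I : Type) (s : seq I) (F : I -> T -> R[i]) :
  (forall i, Linfty mu (F i)) -> Linfty mu (fun x => \prod_(i <- s) F i x).
Proof.
move=> FL; elim: s => [|i s IH].
  by under eq_fun do rewrite big_nil; exact: Linfty_cst.
by under eq_fun do rewrite big_cons; exact: LinftyM.
Qed.

Lemma LinftyX n (f : T -> R[i]) : Linfty mu f -> Linfty mu (fun x => f x ^+ n).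
Proof.
move=> fL; elim: n => [|n IH].
  by under eq_fun do rewrite expr0; exact: Linfty_cst.
by under eq_fun do rewrite exprS; exact: LinftyM.
Qed.

Lemma Linfty_sum (I : Type) (s : seq I) (F : I -> T -> R[i]) :
  (forall i, Linfty mu (F i)) -> Linfty mu (fun x => \sum_(i <- s) F i x).
Proof.
move=> FL; elim: s => [|i s IH].
  by under eq_fun do rewrite big_nil; exact: Linfty_cst.
by under eq_fun do rewrite big_cons; exact: LinftyD.
Qed.

End LinftyBig.

(** * Monomials in the matrix entries and their degrees *)

Section Monomials.
Context (R : realType) (p q : nat).
Implicit Types (e : 'I_p -> 'I_q -> nat) (Z : 'M[R[i]]_(p, q)).

Definition mon e Z : R[i] := \prod_(i < p) \prod_(j < q) Z i j ^+ e i j.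
Definition mdeg e : nat := \sum_(i < p) \sum_(j < q) e i j.
Definition madd e e' i j : nat := (e i j + e' i j)%N.
Definition munit (k : 'I_p) (l : 'I_q) (i : 'I_p) (j : 'I_q) : nat :=
  ((i == k) && (j == l))%N.

Lemma monM e e' Z : mon e Z * mon e' Z = mon (madd e e') Z.
Proof.
rewrite -big_split; apply: eq_bigr => i _; rewrite -big_split; apply: eq_bigr => j _.
by rewrite exprD.
Qed.

Lemma mdegD e e' : mdeg (madd e e') = (mdeg e + mdeg e')%N.
Proof. by rewrite /mdeg -big_split; apply: eq_bigr => i _; rewrite -big_split. Qed.

Lemma monZ c e Z : mon e (c *: Z) = c ^+ mdeg e * mon e Z.
Proof.
rewrite /mon /mdeg (big_morph _ (exprD c) (expr0 c)) -big_split; apply: eq_bigr => i _.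
rewrite (big_morph _ (exprD c) (expr0 c)) -big_split; apply: eq_bigr => j _.
by rewrite mxE exprMn.
Qed.

Lemma mon0 Z : mon (fun _ _ => 0%N) Z = 1.
Proof. by rewrite /mon big1// => i _; rewrite big1. Qed.

Lemma mdeg0 : mdeg (fun _ _ => 0%N) = 0%N.
Proof. by rewrite /mdeg big1// => i _; rewrite big1. Qed.

Lemma mon_unit k l Z : mon (munit k l) Z = Z k l.
Proof.
rewrite /mon (bigD1 k)//= (bigD1 l)//= /munit !eqxx expr1.
rewrite !big1 ?mulr1// => [i /negPf -> |j /negPf ->]; last by rewrite andbF.
by rewrite big1.
Qed.

Lemma mdeg_unit k l : mdeg (munit k l) = 1%N.
Proof.
rewrite /mdeg (bigD1 k)//= (bigD1 l)//= /munit !eqxx.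
rewrite !big1 ?addn0// => [i /negPf -> |j /negPf ->]; last by rewrite andbF.
by rewrite big1.
Qed.

Lemma poly_fun_mon c e : poly_fun (fun Z => c * mon e Z).
Proof. by exists 1%N, (fun=> c), (fun=> e) => Z; rewrite big_ord1. Qed.

Lemma poly_fun0 : poly_fun (fun _ : 'M[R[i]]_(p, q) => 0).
Proof. by exists 0%N, (fun=> 0), (fun _ _ _ => 0%N) => Z; rewrite big_ord0. Qed.

Lemma poly_funZ c (P : 'M[R[i]]_(p, q) -> R[i]) : poly_fun P -> poly_fun (fun Z => c * P Z).
Proof.
move=> [N [a [e PE]]]; exists N, (fun k => c * a k), e => Z.
by rewrite PE big_distrr /=; apply: eq_bigr => k _; rewrite mulrA.
Qed.

Lemma poly_funD (P Q : 'M[R[i]]_(p, q) -> R[i]) :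
  poly_fun P -> poly_fun Q -> poly_fun (fun Z => P Z + Q Z).
Proof.
move=> [N [a [e PE]]] [M [b [f QE]]].
exists (N + M)%N, (fun k => match fintype.split k with inl i => a i | inr j => b j end),
  (fun k => match fintype.split k with inl i => e i | inr j => f j end) => Z.
rewrite PE QE big_split_ord; congr (_ + _); apply: eq_bigr => k _.
  by rewrite (unsplitK (inl k)).
by rewrite (unsplitK (inr k)).
Qed.

End Monomials.

(** * Measurability of coordinates and scalings *)

Section Coordinates.
Context (R : realType) (p q : nat).

Lemma cmeasurable_coord (i : 'I_p) (j : 'I_q) :
  cmeasurable (fun Z : Amb R p q => (Z : 'M[R[i]]_(p, q)) i j).
Proof.
by split=> _ B mB; rewrite setTI; apply: sub_sigma_algebra; exists i, j, B;
  split => //; [left|right].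
Qed.

Lemma measurable_scale (c : R[i]) : @measurable_fun _ _ (Amb R p q) (Amb R p q)
  setT (fun Z => c *: (Z : 'M[R[i]]_(p, q))).
Proof.
apply: (@measurability _ _ (Amb R p q) (Amb R p q) setT
  (fun Z => c *: (Z : 'M[R[i]]_(p, q))) (coord_sets R p q)) => //.
move=> _ [_ [i [j [B [mB [->|->]]]]] <-].
  have [+ _] := cmeasurableM (cmeasurable_cst _ c) (cmeasurable_coord i j).
  move=> /(_ measurableT _ mB); congr (measurable (_ `&` _)).
  by apply/seteqP; split => Z /=; rewrite mxE.
have [_ +] := cmeasurableM (cmeasurable_cst _ c) (cmeasurable_coord i j).
move=> /(_ measurableT _ mB); congr (measurable (_ `&` _)).
by apply/seteqP; split => Z /=; rewrite mxE.
Qed.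

End Coordinates.

(** * Circular measures on a sphere: orthogonality and greedy choice of monomials *)

Section CircularMeasure.
Context (R : realType) (p q : nat) (mu : probability (Amb R p q) R) (r : R).
Hypothesis r0 : 0 < r.
Hypothesis sphere : {ae mu, forall Z : Amb R p q,
  \sum_(ij : 'I_p * 'I_q) cabs2 ((Z : 'M[R[i]]_(p, q)) ij.1 ij.2) = r}.
Hypothesis circular : forall v : R[i], `|v| = 1 ->
  forall A : set (Amb R p q), measurable A ->
  mu ((fun Z : Amb R p q => (v ^+ 2 *: (Z : 'M[R[i]]_(p, q)) : Amb R p q)) @^-1` A) = mu A.
Implicit Types (e : 'I_p -> 'I_q -> nat) (Z : Amb R p q).

Lemma coord_le_ae (i : 'I_p) (j : 'I_q) :
  {ae mu, forall Z, cabs2 ((Z : 'M[R[i]]_(p, q)) i j) <= r}.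
Proof.
apply: filterS sphere => Z <-; rewrite (bigD1 (i, j))//= lerDl.
by apply: sumr_ge0 => *; exact: cabs2_ge0.
Qed.

Lemma Linfty_coord (i : 'I_p) (j : 'I_q) :
  Linfty mu (fun Z => (Z : 'M[R[i]]_(p, q)) i j).
Proof. by split; [exact: cmeasurable_coord|exists r; exact: coord_le_ae]. Qed.

Lemma Linfty_mon e : Linfty mu (fun Z => mon e Z).
Proof.
by apply: Linfty_prod => i; apply: Linfty_prod => j; apply: LinftyX; exact: Linfty_coord.
Qed.

Lemma Linfty_cmon c e : Linfty mu (fun Z => c * mon e Z).
Proof. by apply: LinftyM (Linfty_mon e); exact: Linfty_cst. Qed.

Lemma L2_cmon c e : L2 mu (fun Z => c * mon e Z).
Proof. exact/Linfty_L2/Linfty_cmon. Qed.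

Lemma L2_poly (P : 'M[R[i]]_(p, q) -> R[i]) : poly_fun P -> L2 mu (P : Amb R p q -> R[i]).
Proof.
move=> [N [c [e PE]]]; rewrite (funext PE : P = _).
by apply/Linfty_L2/Linfty_sum => k; exact: Linfty_cmon.
Qed.

Lemma hardy_poly (P : 'M[R[i]]_(p, q) -> R[i]) : poly_fun P -> hardy mu P.
Proof.
move=> PP; split; first exact: L2_poly.
move=> eps e0; exists P; split => //; rewrite /dist2.
under eq_integral do rewrite subrr /cabs2 /= expr0n addr0.
by rewrite integral0 lte_fin.
Qed.

(** [toeplitz_compact] speaks of given projections [g]; this supplies them. *)
Lemma szego_exists (f : Amb R p q -> R[i]) : L2 mu f -> exists g, szego mu f g.
Proof.
move=> fL.
have [||||g g1 g2] := @projection_exists _ _ _ mu (@poly_fun R p q) _ _ _ _ f fL.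
- by move=> P; exact: L2_poly.
- exact: poly_fun0.
- exact: poly_funD.
- exact: poly_funZ.
by exists g.
Qed.

Lemma exists_rootN1 (k : nat) : (0 < k)%N ->
  exists2 v : R[i], `|v| = 1 & (v ^+ 2) ^+ k = -1.
Proof.
move=> k0; have k2 : (0 < 2 * k)%N by rewrite muln_gt0.
exists ((2 * k)%N.-root (-1)); last by rewrite -exprM rootCK.
by apply/eqP; rewrite -(@pexpr_eq1 _ _ (2 * k)%N)// -normrX rootCK// normrN1.
Qed.

(* Rotating by [v ^+ 2] multiplies the integrand by [-1]. *)
Lemma ip_mon_eq0 c c' e e' : (mdeg e < mdeg e')%N ->
  ip mu (fun Z => c * mon e Z) (fun Z => c' * mon e' Z) = 0.
Proof.
move=> ee'; have [|v v1 vN] := @exists_rootN1 (mdeg e' - mdeg e); first by rewrite subn_gt0.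
pose f : Amb R p q -> R := rdot (fun Z => c * mon e Z) (fun Z => c' * mon e' Z).
have fi : mu.-integrable setT (EFin \o f) by apply: integrable_rdot; exact: L2_cmon.
have mf : measurable_fun setT (EFin \o f) by case/integrableP: fi.
have fs Z : f (v ^+ 2 *: (Z : 'M[R[i]]_(p, q))) = - f Z.
  have fE Y : f Y = complex.Re (c * mon e Y * Num.conj (c' * mon e' Y)).
    by rewrite /f /rdot !reimE; ring.
  rewrite !fE !monZ -ReN; congr complex.Re.
  rewrite -(subnK (ltnW ee')) exprD vN !rmorphM rmorphN1 /=.
  set w := (v ^+ 2) ^+ mdeg e.
  have w1 : w * Num.conj w = 1 by rewrite -normCK !normrX v1 !expr1n.
  transitivity (- (w * Num.conj w) * (c * mon e Z * (Num.conj c' * Num.conj (mon e' Z)))).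
    by ring.
  by rewrite w1 mulN1r.
have := @integral_invariant _ _ _ mu _ _ (@measurable_scale R p q (v ^+ 2)) (circular v1) mf.
have -> : (EFin \o f) \o (fun Z : Amb R p q => v ^+ 2 *: (Z : 'M[R[i]]_(p, q))) =
          EFin \o (fun Z => - f Z).
  by apply/funext => Z /=; rewrite fs.
have Nfi : mu.-integrable setT (EFin \o (fun Z => - f Z)).
  by have := integrableN fi; exact: eq_integrable.
move=> /(_ Nfi) /(congr1 fine).
rewrite -/(Rintegral mu setT f) -/(Rintegral mu setT _) => h.
have : ip mu (fun Z => c * mon e Z) (fun Z => c' * mon e' Z) =
   - ip mu (fun Z => c * mon e Z) (fun Z => c' * mon e' Z).
  rewrite /ip -{1}h -mulN1r -RintegralZl//.
  by congr fine; apply: eq_integral => Z _ /=; rewrite fs mulN1r.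
by lra.
Qed.

(** [D] exceeds every degree occurring in [P], so [ip_mon_eq0] applies term by term. *)
Lemma poly_orthogonal (P : 'M[R[i]]_(p, q) -> R[i]) : poly_fun P ->
  exists D : nat, forall c e, (D <= mdeg e)%N -> ip mu P (fun Z => c * mon e Z) = 0.
Proof.
move=> [N [a [f PE]]]; exists (\max_(k < N) mdeg (f k)).+1 => c e De.
rewrite (funext PE : P = _).
transitivity (\int[mu]_x (\sum_(k < N)
    rdot (fun Z => a k * mon (f k) Z) (fun Z => c * mon e Z) x))%R.
  apply: eq_Rintegral => Z _; rewrite /rdot.
  rewrite (big_morph _ (@ReD R) erefl) (big_morph _ (@ImD R) erefl).
  by rewrite !mulr_suml -big_split.
rewrite Rintegral_sum; last by move=> k; apply: integrable_rdot; exact: L2_cmon.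
apply: big1 => k _; apply: ip_mon_eq0; apply: leq_trans De.
by rewrite ltnS; exact: leq_bigmax.
Qed.

Definition mnorm2 e : R := (\int[mu]_Z cabs2 (mon e Z))%R.

Lemma integrable_cabs2_mon e : mu.-integrable setT (EFin \o (fun Z => cabs2 (mon e Z))).
Proof. by have /L2P[] := Linfty_L2 (Linfty_mon e). Qed.

Lemma sum_cabs2_mon e : {ae mu, forall Z : Amb R p q,
  \sum_(ij : 'I_p * 'I_q) cabs2 (mon (madd e (munit ij.1 ij.2)) Z) = r * cabs2 (mon e Z)}.
Proof.
apply: filterS sphere => Z <-; rewrite mulr_suml; apply: eq_bigr => ij _.
by rewrite -monM cabs2M mon_unit mulrC.
Qed.

(* As [\sum_(i, j) `|Z i j * f|^2 = r * `|f|^2], some [Z i j * f] keeps the weighted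
   average of [w] at least as large as it is for [f]. *)
Lemma greedy_monomial (w : Amb R p q -> R) (M : R) :
  measurable_fun setT w -> {ae mu, forall Z, `|w Z| <= M} ->
  forall n, exists e, [/\ mdeg e = n, 0 < mnorm2 e &
    `|\int[mu]_Z w Z| * mnorm2 e <= `|\int[mu]_Z (cabs2 (mon e Z) * w Z)|]%R.
Proof.
move=> mw wM; set a := (`|Rintegral _ _ _|)%R.
pose J e : R := (\int[mu]_Z (cabs2 (mon e Z) * w Z))%R.
have mJ e : measurable_fun setT (fun Z => cabs2 (mon e Z) * w Z).
  apply: measurable_funM => //; apply: measurable_cabs2.
  by have [] := Linfty_mon e.
have iJ e : mu.-integrable setT (EFin \o (fun Z => cabs2 (mon e Z) * w Z)).
  apply: (@ae_dominated_integrable _ _ _ mu _ (fun Z => M * cabs2 (mon e Z))) => //.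
    by have := integrableZl measurableT M (integrable_cabs2_mon e); exact: eq_integrable.
  apply: filterS wM => Z wM; rewrite normrM ger0_norm ?cabs2_ge0// mulrC.
  by rewrite ler_wpM2r ?cabs2_ge0.
have JM e : `|J e| <= M * mnorm2 e.
  apply: le_trans (le_normr_Rintegral measurableT (iJ e)) _.
  rewrite -RintegralZl//; last exact: integrable_cabs2_mon.
  apply: ae_le_Rintegral.
  - by have := integrable_norm (iJ e); exact: eq_integrable.
  - by have := integrableZl measurableT M (integrable_cabs2_mon e); exact: eq_integrable.
  - apply: filterS wM => Z wM; rewrite normrM ger0_norm ?cabs2_ge0// mulrC.
    by rewrite ler_wpM2r ?cabs2_ge0.
have K0 e : 0 <= mnorm2 e by apply: Rintegral_ge0 => Z _; exact: cabs2_ge0.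
pose up e ij := madd e (munit ij.1 ij.2).
have sumK e : \sum_ij mnorm2 (up e ij) = r * mnorm2 e.
  rewrite /mnorm2 -Rintegral_sum; last by move=> ij; exact: integrable_cabs2_mon.
  rewrite -RintegralZl//; last exact: integrable_cabs2_mon.
  apply: ae_eq_Rintegral; last exact: sum_cabs2_mon.
    by apply: measurable_sum => ij; apply: measurable_cabs2; have [] := Linfty_mon (up e ij).
  by apply: measurable_funM => //; apply: measurable_cabs2; have [] := Linfty_mon e.
have sumJ e : \sum_ij J (up e ij) = r * J e.
  rewrite /J -Rintegral_sum// -RintegralZl//.
  apply: ae_eq_Rintegral.
  - by apply: measurable_sum => ij; exact: mJ.
  - by apply: measurable_funM => //; exact: mJ.
  - by apply: filterS (sum_cabs2_mon e) => Z sZ; rewrite -mulr_suml sZ mulrA.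
elim=> [|n [e [en Ke Je]]].
  exists (fun _ _ => 0%N); rewrite mdeg0.
  have K1 : mnorm2 (fun _ _ => 0%N) = 1.
    rewrite /mnorm2; under eq_Rintegral do rewrite mon0 /cabs2 /= expr1n expr0n addr0.
    by rewrite Rintegral_cst// mul1r; exact: (congr1 fine (probability_setT mu)).
  rewrite K1; split => //.
  rewrite mulr1 le_eqVlt; apply/orP; left; apply/eqP; congr `|_|.
  by apply: eq_Rintegral => Z _; rewrite mon0 /cabs2 /= expr1n expr0n addr0 mul1r.
apply: contrapT => nex.
(* If no successor works, [c] is nonnegative, and positive wherever the norm is, while the induction
   hypothesis makes its sum at most 0. So all successors have norm zero, against [sumK] and
   [0 < mnorm2 e]. *)
pose c ij := a * mnorm2 (up e ij) - `|J (up e ij)|.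
have cpos ij : 0 < mnorm2 (up e ij) -> 0 < c ij.
  move=> kp; rewrite subr_gt0 ltNge; apply/negP => le; apply: nex.
  by exists (up e ij); split => //; rewrite mdegD mdeg_unit en addn1.
have c0 ij : 0 <= c ij.
  have := K0 (up e ij); rewrite le_eqVlt => /predU1P[k0|/cpos/ltW//].
  have := JM (up e ij); rewrite /c -k0 !mulr0 sub0r oppr_ge0; exact.
have sc : \sum_ij c ij <= 0.
  rewrite sumrB -mulr_sumr sumK subr_le0.
  apply: (@le_trans _ _ `|\sum_ij J (up e ij)|); last exact: ler_norm_sum.
  by rewrite sumJ normrM (gtr0_norm r0) mulrCA ler_pM2l.
have : r * mnorm2 e = 0.
  rewrite -sumK; apply: big1 => ij _; apply/eqP; rewrite eq_le K0 andbT leNgt.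
  apply/negP => /cpos; apply/negP; rewrite -leNgt.
  apply: le_trans sc; rewrite (bigD1 ij)//= lerDl.
  by apply: sumr_ge0.
by apply/eqP; rewrite mulf_neq0// gt_eqF.
Qed.

End CircularMeasure.

(** * Compactness forces the moments of the symbol to vanish *)

Section CompactToeplitz.
Context (R : realType) (p q : nat) (mu : probability (Amb R p q) R) (r : R).
Hypothesis r0 : 0 < r.
Hypothesis sphere : {ae mu, forall Z : Amb R p q,
  \sum_(ij : 'I_p * 'I_q) cabs2 ((Z : 'M[R[i]]_(p, q)) ij.1 ij.2) = r}.
Hypothesis circular : forall v : R[i], `|v| = 1 ->
  forall A : set (Amb R p q), measurable A ->
  mu ((fun Z : Amb R p q => (v ^+ 2 *: (Z : 'M[R[i]]_(p, q)) : Amb R p q)) @^-1` A) = mu A.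
Implicit Types (e : 'I_p -> 'I_q -> nat) (Z : Amb R p q) (f g : Amb R p q -> R[i]).

Lemma toeplitz_compact_moment (phi : Amb R p q -> R[i]) :
  Linfty mu phi -> toeplitz_compact mu phi -> forall c e1 e2,
  (\int[mu]_Z complex.Re (phi Z * (c * mon e1 Z) * Num.conj (mon e2 Z)) = 0)%R.
Proof.
move=> phiL phiC c e1 e2; apply/eqP/negPn/negP => a0.
set w := (fun Z => complex.Re (phi Z * _ * _)) in a0.
have m1L := Linfty_cmon sphere c e1; have m2L := Linfty_mon sphere e2.
have [mw [M wM]] := Linfty_Re (LinftyM (LinftyM phiL m1L) (LinftyJ m2L)).
have /choice[e eP] := greedy_monomial r0 sphere mw wM.
have [_ [C1 m1C]] := m1L; have [_ [C2 m2C]] := m2L.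
(* A common bound for the squared moduli of the two fixed monomials; adding 1 makes it positive. *)
pose C := `|C1| + `|C2| + 1.
have C0 : 0 < C by rewrite ltr_wpDl// addr_ge0.
have C1C : C1 <= C by have := ler_norm C1; have := normr_ge0 C2; rewrite /C; lra.
have C2C : C2 <= C by have := ler_norm C2; have := normr_ge0 C1; rewrite /C; lra.
pose K n := mnorm2 mu (e n).
have K0 n : 0 < K n by have [] := eP n.
pose s n := (Num.sqrt (C * K n))^-1.
have s2 n : s n ^+ 2 = (C * K n)^-1.
  by rewrite /s exprVn sqr_sqrtr// ltW// mulr_gt0.
(* Used for both [h] and [k]: the squared norm is at most [s n ^+ 2 * C * K n], which the choice of
   [s] makes 1. *)
have nrm n (u b : Amb R p q -> R[i]) :
    (forall Z, u Z = ((s n)%:C)%C * (mon (e n) Z * b Z)) -> L2 mu u ->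
    {ae mu, forall Z, cabs2 (b Z) <= C} -> ip mu u u <= 1.
  move=> uE uL bC.
  have iK := integrable_cabs2_mon sphere (e n).
  have -> : 1 = s n ^+ 2 * C * K n.
    by rewrite s2; field; rewrite !gt_eqF.
  rewrite /K /mnorm2 -RintegralZl//; apply: ae_le_Rintegral.
  - exact: integrable_rdot.
  - by have := integrableZl measurableT (s n ^+ 2 * C) iK; exact: eq_integrable.
  - apply: filterS bC => Z bC; rewrite /rdot -!expr2 -/(cabs2 (u Z)) uE !cabs2M cabs2_real.
    rewrite -[leRHS]mulrA ler_wpM2l ?sqr_ge0// mulrC ler_wpM2r ?cabs2_ge0//.
pose h n Z := ((s n)%:C)%C * c * mon (madd (e n) e1) Z.
pose k n Z := ((s n)%:C)%C * mon (madd (e n) e2) Z.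
have hE n Z : h n Z = ((s n)%:C)%C * (mon (e n) Z * (c * mon e1 Z)).
  by rewrite /h -monM; ring.
have kE n Z : k n Z = ((s n)%:C)%C * (mon (e n) Z * mon e2 Z) by rewrite /k -monM.
have hL n : L2 mu (h n) by exact: (L2_cmon sphere).
have kL n : L2 mu (k n) by exact: (L2_cmon sphere).
have h1 n : ip mu (h n) (h n) <= 1.
  by apply: nrm (hE n) (hL n) _; apply: filterS m1C => Z /le_trans; exact.
have k1 n : ip mu (k n) (k n) <= 1.
  by apply: nrm (kE n) (kL n) _; apply: filterS m2C => Z /le_trans; exact.
have phL n : L2 mu (fun Z => phi Z * h n Z) by exact: L2_LinftyM.
have /choice[g gP] n := szego_exists sphere (phL n).
have gL n : L2 mu (g n) by have [[]] := gP n.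
have [||sg [l [sgI [lL cvl]]]] := phiC h g.
- move=> n; split; first by apply: (hardy_poly sphere); exact: poly_fun_mon.
  rewrite dist2E//; last exact/Linfty_L2/Linfty_cst.
  have -> : (fun x => h n x - 0) = h n by apply/funext => x; rewrite subr0.
  by rewrite lee_fin.
- exact: gP.
set a := Rintegral _ _ _ in a0.
(* As [k n] is in the Hardy space, [g n] may be replaced by [phi * h n]; the product is then
   [s n ^+ 2] times the weighted integral of [w], which the greedy choice bounds below by the
   modulus of [a] times [K n]. *)
have ipgk n : `|a| / C <= `|ip mu (g n) (k n)|.
  have hk : hardy mu (k n) by apply: (hardy_poly sphere); exact: poly_fun_mon.
  have := orthogonal2_ip (L2B (phL n) (gL n)) (kL n) ((gP n).2 _ hk).
  rewrite ipBl// => /eqP; rewrite subr_eq0 => /eqP <-.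
  have -> : ip mu (fun Z => phi Z * h n Z) (k n) =
      s n ^+ 2 * (\int[mu]_Z (cabs2 (mon (e n) Z) * w Z))%R.
    rewrite -RintegralZl//; last first.
      apply: (@ae_dominated_integrable _ _ _ mu _ (fun Z => M * cabs2 (mon (e n) Z))).
      - apply: measurable_funM => //; apply: measurable_cabs2.
        by have [] := Linfty_mon sphere (e n).
      - by have := integrableZl measurableT M (integrable_cabs2_mon sphere (e n));
          exact: eq_integrable.
      - apply: filterS wM => Z wM; rewrite normrM ger0_norm ?cabs2_ge0// mulrC.
        by rewrite ler_wpM2r ?cabs2_ge0.
    apply: eq_Rintegral => Z _; rewrite rdotE hE kE !rmorphM /=.
    have -> : Num.conj ((s n)%:C)%C = ((s n)%:C)%C :> R[i].
      by apply/eqP; rewrite eq_complex !reimE /= oppr0 !eqxx.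
    transitivity (complex.Re (((s n)%:C)%C ^+ 2 * (mon (e n) Z * Num.conj (mon (e n) Z)) *
        (phi Z * (c * mon e1 Z) * Num.conj (mon e2 Z)))).
      by congr complex.Re; ring.
    by rewrite mulcJ -rmorphXn -rmorphM ReM /= mul0r subr0 -[LHS]mulrA.
  have [_ _ le] := eP n; rewrite normrM (ger0_norm (sqr_ge0 (s n))) s2.
  apply: (@le_trans _ _ ((C * K n)^-1 * (`|a| * K n))).
    by rewrite le_eqVlt; apply/orP; left; apply/eqP; field; rewrite !gt_eqF.
  by rewrite ler_pM2l// invr_gt0 mulr_gt0.
pose dl := (`|a| / C) ^+ 2.
have dl0 : 0 < dl by rewrite exprn_gt0// divr_gt0// normr_gt0.
(* The final estimate is [2 * (2 * eps + 2 * eps) + 2 * eps = 10 * eps], which is half of [dl]. *)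
pose eps := dl / 20.
have eps0 : 0 < eps by rewrite divr_gt0.
have [n0 n0P] : exists n0, forall n, (n0 <= n)%N ->
    ip mu (fun x => g (sg n) x - l x) (fun x => g (sg n) x - l x) < eps.
  have nb : nbhs (0%E : \bar R) [set x | (x < eps%:E)%E].
    by apply: open_ereal_lt'; rewrite lte_fin.
  have [n0 _ H] := cvl _ nb; exists n0 => n nn0.
  have : (dist2 mu (g (sg n)) l < eps%:E)%E := H n nn0.
  by rewrite dist2E.
(* The polynomial approximates [g (sg n0)], known to be in the Hardy space, whereas the limit [l] is
   only given in L2. *)
have [[_ /(_ _ eps0)[P [PP gP0]]] _] := gP (sg n0).
have PL := L2_poly sphere PP; rewrite dist2E// lte_fin in gP0.
have [D DP] := poly_orthogonal sphere circular PP.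
(* [e (sg n)] has degree [sg n], which is at least [n] and hence at least [D]. *)
pose n := maxn n0 D.
have sgn : (n <= sg n)%N by elim: (n) => // m IH; exact: leq_ltn_trans IH (sgI m).
have Pk : ip mu P (k (sg n)) = 0.
  apply: DP; rewrite mdegD; have [-> _ _] := eP (sg n).
  by apply: leq_trans (leq_addr _ _); apply: leq_trans sgn; rewrite leq_maxr.
have big : dl <= ip mu (fun x => g (sg n) x - P x) (fun x => g (sg n) x - P x).
  apply: (@le_trans _ _ (ip mu (g (sg n)) (k (sg n)) ^+ 2)).
    rewrite -(real_normK (num_real (ip _ _ _))) lerXn2r ?nnegrE ?normr_ge0//.
    by rewrite divr_ge0// ltW.
  rewrite -[X in X ^+ 2]subr0 -Pk -ipBl//.
  apply: le_trans (cauchy_schwarz (L2B (gL _) PL) (kL _)) _.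
  by rewrite ler_piMr// ip_ge0.
have : ip mu (fun x => g (sg n) x - P x) (fun x => g (sg n) x - P x) <= 10 * eps.
  have -> : (fun x => g (sg n) x - P x) =
      (fun x => ((g (sg n) x - l x) - (g (sg n0) x - l x)) + (g (sg n0) x - P x)).
    by apply/funext => x; ring.
  have n1 := n0P _ (leqnn n0); have n2 := n0P _ (leq_maxl n0 D).
  have L1 := L2B (gL (sg n)) lL; have L0 := L2B (gL (sg n0)) lL.
  have := ip_normD_le (L2B L1 L0) (L2B (gL (sg n0)) PL).
  have := ip_normB_le L1 L0.
  by move: n1 n2 gP0; rewrite -/n; lra.
by rewrite /eps in big *; lra.
Qed.

End CompactToeplitz.

(** * Polynomials converging to a step function on the unit interval *)

Section PolynomialStep.
Context (R : realType).
Implicit Types u t : R.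

(** An upper counterpart of Bernoulli's inequality, cleared of denominators. In the induction, 1 + n
    (1 - u) exceeds u (1 + (n + 1) (1 - u)) by (n + 1) (1 - u)^2. *)
Lemma exprn_le_inv_affine u n : 0 <= u <= 1 -> u ^+ n * (1 + n%:R * (1 - u)) <= 1.
Proof.
move=> /andP[u0 u1]; elim: n => [|n IH]; first by rewrite mul0r addr0 mulr1.
apply: le_trans IH; rewrite exprSr -mulrA ler_wpM2l ?exprn_ge0// -natr1.
have n0 : 0 <= n%:R :> R by [].
have := mulr_ge0 n0 (sqr_ge0 (1 - u)).
by have := sqr_ge0 (1 - u); nra.
Qed.

Lemma bernoulli u n : 0 <= u <= 1 -> 1 - n%:R * (1 - u) <= u ^+ n.
Proof.
move=> /andP[u0 u1]; elim: n => [|n IH]; first by rewrite mul0r subr0.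
have : u ^+ n <= 1 by rewrite exprn_ile1.
by rewrite exprSr -natr1; nra.
Qed.

(** With [v] the square root of [u], the previous bound gives n v^n <= 1 / (1 - v), so n u^n is at
    most the geometric term v^n / (1 - v). *)
Lemma cvg_natr_expr u : 0 <= u < 1 -> (fun n => n%:R * u ^+ n) @ \oo --> (0 : R).
Proof.
move=> /andP[u0 u1]; pose v := Num.sqrt u.
have v0 : 0 <= v by exact: sqrtr_ge0.
have v1 : v < 1 by rewrite -sqrtr1 ltr_sqrt.
have cv : geometric (1 - v)^-1 v @ \oo --> (0 : R).
  by apply: cvg_geometric; rewrite ger0_norm.
apply: (squeeze_cvgr _ (cvg_cst 0) cv); apply: nearW => n.
rewrite mulr_ge0 ?exprn_ge0//= /geometric /= [leRHS]mulrC ler_pdivlMr ?subr_gt0//.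
have -> : u = v * v by rewrite -expr2 sqr_sqrtr.
have /(exprn_le_inv_affine n) : 0 <= v <= 1 by rewrite v0 ltW.
rewrite exprMn; have := exprn_ge0 n v0; move: (v ^+ n) => x x0 h.
have : x * (x * (n%:R * (1 - v))) <= x * 1 by rewrite ler_wpM2l//; nra.
by nra.
Qed.

(** With N = n 2^n, the product N t^n = n (2 t)^n tends to 0 below 1/2 and is at least n from 1/2
    on. The extra factor [n] in the exponent settles the point 1/2 itself. *)
Definition step_poly n t : R := (1 - t ^+ n) ^+ (n * 2 ^ n).

Lemma step_poly_itv n t : 0 <= t <= 1 -> 0 <= step_poly n t <= 1.
Proof.
move=> /andP[t0 t1]; have := exprn_ge0 n t0.
have : t ^+ n <= 1 by rewrite exprn_ile1.
by move=> h1 h2; rewrite exprn_ge0 ?exprn_ile1//; lra.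
Qed.

(** Below 1/2, [bernoulli] squeezes the value between 1 - n (2 t)^n and 1; from 1/2 on,
    [exprn_le_inv_affine] bounds it by 1 / (n + 1). *)
Lemma step_poly_cvg t : 0 <= t <= 1 ->
  (fun n => step_poly n t) @ \oo --> ((t < 2^-1)%R%:R : R).
Proof.
move=> t01; have /andP[t0 t1] := t01.
have tn n : 0 <= 1 - t ^+ n <= 1.
  by have := exprn_ge0 n t0; have : t ^+ n <= 1 by [rewrite exprn_ile1]; lra.
have [t2|t2] := ltP t 2^-1; rewrite /= ?mulr1n ?mulr0n.
  have cv : (fun n => 1 - n%:R * (2 * t) ^+ n) @ \oo --> (1 - 0 : R).
    by apply: cvgB; [exact: cvg_cst|apply: cvg_natr_expr; lra].
  rewrite subr0 in cv.
  have c1 : (fun=> 1 : R) @ \oo --> (1 : R) by exact: cvg_cst.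
  apply: (squeeze_cvgr _ cv c1); apply: nearW => n.
  have /andP[_ ->] := step_poly_itv n t01; rewrite andbT.
  apply: le_trans (bernoulli _ (tn n)); rewrite natrM natrX exprMn.
  by rewrite opprB addrCA subrr addr0 mulrA.
apply: (squeeze_cvgr _ (cvg_cst 0) cvg_harmonic); apply: nearW => n.
have /andP[-> _] := step_poly_itv n t01 => /=.
rewrite /harmonic /= -[leRHS]mul1r ler_pdivlMr ?ltr0n//.
apply: le_trans (exprn_le_inv_affine (n * 2 ^ n) (tn n)).
rewrite ler_wpM2l//; first by have /andP[] := step_poly_itv n t01.
rewrite opprB addrCA subrr addr0 natrM natrX -mulrA -exprMn -natr1 addrC lerD2l.
rewrite ler_peMr// exprn_ege1//; lra.
Qed.

End PolynomialStep.

(** * A bounded function orthogonal to all polynomials in Z and its conjugate vanishes *)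

Section MomentProblem.
Context (R : realType) (p q : nat) (mu : probability (Amb R p q) R) (r : R).
Hypothesis sphere : {ae mu, forall Z : Amb R p q,
  \sum_(ij : 'I_p * 'I_q) cabs2 ((Z : 'M[R[i]]_(p, q)) ij.1 ij.2) = r}.
Implicit Types (e : 'I_p -> 'I_q -> nat) (Z : Amb R p q) (w t : Amb R p q -> R).

(** As [c] varies, these real functions cover both parts of every monomial in Z and its
    conjugate. *)
Definition test c e1 e2 Z : R := complex.Re (c * mon e1 Z * Num.conj (mon e2 Z)).

Definition annihilator w := [/\ measurable_fun setT w,
  exists M, {ae mu, forall Z, `|w Z| <= M} &
  forall c e1 e2, (\int[mu]_Z (w Z * test c e1 e2 Z) = 0)%R].

(** Multipliers form an algebra closed under bounded pointwise limits, which is how indicators are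
    reached from coordinates. *)
Definition multiplier t := forall w, annihilator w -> annihilator (fun Z => t Z * w Z).

Lemma test_bounded c e1 e2 : measurable_fun setT (test c e1 e2) /\
  exists M, {ae mu, forall Z, `|test c e1 e2 Z| <= M}.
Proof.
apply: (@Linfty_Re _ _ _ mu (fun Z => c * mon e1 Z * Num.conj (mon e2 Z))).
by apply: LinftyM (LinftyJ (Linfty_mon sphere e2)); exact: (Linfty_cmon sphere).
Qed.

Lemma integrable_test w M c e1 e2 : measurable_fun setT w ->
  {ae mu, forall Z, `|w Z| <= M} ->
  mu.-integrable setT (EFin \o (fun Z => w Z * test c e1 e2 Z)).
Proof.
move=> mw wM; have [mt [N tN]] := test_bounded c e1 e2.
apply: (@ae_dominated_integrable _ _ _ mu _ (fun=> M * N)); last 2 first.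
- exact: integrable_cst.
- by apply: filterS2 wM tN => Z wM tN; rewrite normrM ler_pM.
exact: measurable_funM.
Qed.

Lemma annihilatorD w1 w2 : annihilator w1 -> annihilator w2 ->
  annihilator (fun Z => w1 Z + w2 Z).
Proof.
move=> [m1 [M1 b1] z1] [m2 [M2 b2] z2]; split; first exact: measurable_funD.
  exists (M1 + M2); apply: filterS2 b1 b2 => Z b1 b2.
  by apply: le_trans (ler_normD _ _) _; exact: lerD.
move=> c e1 e2; under eq_Rintegral do rewrite mulrDl.
by rewrite RintegralD ?z1 ?z2 ?addr0//; [exact: integrable_test b1|exact: integrable_test b2].
Qed.

Lemma multiplier_cst a : multiplier (fun=> a).
Proof.
move=> w [mw [M wM] z]; split; first exact: measurable_funM.
  by exists (`|a| * M); apply: filterS wM => Z wM; rewrite normrM ler_wpM2l.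
move=> c e1 e2; under eq_Rintegral do rewrite -mulrA.
by rewrite RintegralZl ?z ?mulr0//; exact: integrable_test wM.
Qed.

Lemma multiplierD t1 t2 : multiplier t1 -> multiplier t2 ->
  multiplier (fun Z => t1 Z + t2 Z).
Proof.
move=> h1 h2 w aw; have := annihilatorD (h1 _ aw) (h2 _ aw).
by under eq_fun do rewrite -mulrDl.
Qed.

Lemma multiplierM t1 t2 : multiplier t1 -> multiplier t2 ->
  multiplier (fun Z => t1 Z * t2 Z).
Proof.
move=> h1 h2 w aw; have := h1 _ (h2 _ aw).
by under eq_fun do rewrite mulrA.
Qed.

Lemma multiplierB t1 t2 : multiplier t1 -> multiplier t2 ->
  multiplier (fun Z => t1 Z - t2 Z).
Proof.
move=> h1 h2; have := multiplierD h1 (multiplierM (multiplier_cst (-1)) h2).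
by under eq_fun do rewrite mulN1r.
Qed.

Lemma multiplier_prod (I : Type) (s : seq I) (F : I -> Amb R p q -> R) :
  (forall i, multiplier (F i)) -> multiplier (fun Z => \prod_(i <- s) F i Z).
Proof.
move=> h; elim: s => [|i s IH].
  by under eq_fun do rewrite big_nil; exact: multiplier_cst.
by under eq_fun do rewrite big_cons; exact: multiplierM.
Qed.

Lemma multiplierX t n : multiplier t -> multiplier (fun Z => t Z ^+ n).
Proof.
move=> h; elim: n => [|n IH].
  by under eq_fun do rewrite expr0; exact: multiplier_cst.
by under eq_fun do rewrite exprS; exact: multiplierM.
Qed.

(** Since Re z = (z + conj z) / 2 and Im z = (z - conj z) / (2 i), either part of a coordinate turns
    a test function into a sum of two others; [c1] and [c2] absorb the coefficients. *)
Lemma multiplier_test (x : Amb R p q -> R) (c1 c2 : R[i] -> R[i])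
    (i : 'I_p) (j : 'I_q) :
  measurable_fun setT x -> (exists M, {ae mu, forall Z, `|x Z| <= M}) ->
  (forall c e1 e2 Z, x Z * test c e1 e2 Z =
     test (c1 c) (madd e1 (munit i j)) e2 Z + test (c2 c) e1 (madd e2 (munit i j)) Z) ->
  multiplier x.
Proof.
move=> mx [N xN] xE w [mw [M wM] z]; split; first exact: measurable_funM.
  by exists (N * M); apply: filterS2 xN wM => Z xN wM; rewrite normrM ler_pM.
move=> c e1 e2.
transitivity (\int[mu]_Z (w Z * test (c1 c) (madd e1 (munit i j)) e2 Z +
   w Z * test (c2 c) e1 (madd e2 (munit i j)) Z))%R.
  by apply: eq_Rintegral => Z _; rewrite mulrAC xE mulrDl ![_ * w Z]mulrC.
by rewrite RintegralD ?z ?addr0//; exact: integrable_test wM.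
Qed.

Lemma coord_Re_bounded (i : 'I_p) (j : 'I_q) :
  let x := fun Z : Amb R p q => complex.Re ((Z : 'M[R[i]]_(p, q)) i j) in
  measurable_fun setT x /\ exists M, {ae mu, forall Z, `|x Z| <= M}.
Proof. exact: (Linfty_Re (Linfty_coord sphere i j)). Qed.

Lemma coord_Im_bounded (i : 'I_p) (j : 'I_q) :
  let x := fun Z : Amb R p q => complex.Im ((Z : 'M[R[i]]_(p, q)) i j) in
  measurable_fun setT x /\ exists M, {ae mu, forall Z, `|x Z| <= M}.
Proof.
(* Im z is the real part of - i z. *)
have [_ [M xM]] := Linfty_Re (LinftyM (Linfty_cst mu (Complex 0 (-1))) (Linfty_coord sphere i j)).
split; first by have [] := cmeasurable_coord R i j.
exists M; apply: filterS xM => Z; congr (`|_| <= _).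
by rewrite ReM /=; ring.
Qed.

Lemma multiplier_Re (i : 'I_p) (j : 'I_q) :
  multiplier (fun Z : Amb R p q => complex.Re ((Z : 'M[R[i]]_(p, q)) i j)).
Proof.
have [mx bx] := coord_Re_bounded i j.
apply: (@multiplier_test _ (fun c => c * Complex 2^-1 0) (fun c => c * Complex 2^-1 0) i j) => //.
by move=> c e1 e2 Z; rewrite /test -!monM mon_unit !reimE /=; field.
Qed.

Lemma multiplier_Im (i : 'I_p) (j : 'I_q) :
  multiplier (fun Z : Amb R p q => complex.Im ((Z : 'M[R[i]]_(p, q)) i j)).
Proof.
have [mx bx] := coord_Im_bounded i j.
apply: (@multiplier_test _ (fun c => c * Complex 0 (- 2^-1))
  (fun c => c * Complex 0 2^-1) i j) => //.
by move=> c e1 e2 Z; rewrite /test -!monM mon_unit !reimE /=; field.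
Qed.

(** Dominated convergence under a constant: the integrals along the sequence are all zero, hence so
    is their limit. *)
Lemma multiplier_lim (tn : nat -> Amb R p q -> R) t :
  (forall n, multiplier (tn n)) -> measurable_fun setT t ->
  {ae mu, forall Z, forall n, `|tn n Z| <= 1} ->
  {ae mu, forall Z, (fun n => tn n Z) @ \oo --> t Z} ->
  multiplier t.
Proof.
move=> htn mt b cv w aw; have [mw [M wM] z] := aw.
have mtw : measurable_fun setT (fun Z => t Z * w Z) by exact: measurable_funM.
have twM : {ae mu, forall Z, `|t Z * w Z| <= M}.
  apply: filterS3 b cv wM => Z b cv wM.
  rewrite normrM -[leRHS]mul1r; apply: ler_pM => //.
  have cn : (fun n => `|tn n Z|) @ \oo --> `|t Z| by exact: cvg_norm.
  rewrite -(cvg_lim _ cn)//; apply: limr_le; first exact: cvgP cn.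
  exact: nearW.
split => //; first by exists M.
move=> c e1 e2; have [ms [N sN]] := test_bounded c e1 e2.
have awn n := htn n _ aw.
have := @dominated_convergence _ _ _ mu setT measurableT
  (fun n Z => (tn n Z * w Z * test c e1 e2 Z)%:E) (fun Z => (t Z * w Z * test c e1 e2 Z)%:E)
  (EFin \o (fun=> M * N)).
case.
- by move=> n; apply/measurable_EFinP; apply: measurable_funM => //; have [] := awn n.
- by apply/measurable_EFinP; exact: measurable_funM.
- apply: filterS cv => Z cv _; apply: cvg_EFin; first exact: nearW.
  by apply: cvgMl; apply: cvgMl.
- exact: integrable_cst.
- apply: filterS3 b wM sN => Z b wM sN n _; rewrite /= lee_fin !normrM ler_pM//.
  by rewrite -[leRHS]mul1r ler_pM.
move=> _ _ cvi.
have /cvg_lim : [sequence (\int[mu]_x (tn n x * w x * test c e1 e2 x)%:E)%E]_n @ \oo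
    --> (0 : \bar R).
  apply: cvg_near_cst; apply: nearW => n.
  have [mn [Mn bn] zn] := awn n.
  by have := EFin_Rintegral (integrable_test c e1 e2 mn bn); rewrite zn.
by move=> /(_ (@ereal_hausdorff R)) h; rewrite /Rintegral -(cvg_lim _ cvi)// h.
Qed.

Definition msets : set (set (Amb R p q)) :=
  [set E | measurable E /\ multiplier (\1_E : Amb R p q -> R)].

Lemma sigma_algebra_msets : sigma_algebra setT msets.
Proof.
split.
- split => //; have := multiplier_cst 0.
  by congr multiplier; apply/funext => Z; rewrite indicE in_set0.
- move=> E [mE hE]; split; first exact: measurableD.
  have := multiplierB (multiplier_cst 1) hE.
  congr multiplier; apply/funext => Z; rewrite !indicE in_setD in_setT /=.
  by case: (_ \in _); rewrite ?subr0 ?subrr.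
move=> F hF; have mF : measurable (\bigcup_k F k).
  by apply: bigcupT_measurable => k; have [] := hF k.
split => //.
(* The indicator of the union of the first [n] sets, written as a polynomial in their indicators. *)
pose tn n Z : R := 1 - \prod_(k < n) (1 - \1_(F k) Z).
have tn0 n Z k : (k < n)%N -> F k Z -> tn n Z = 1.
  move=> kn FZ; rewrite /tn (bigD1 (Ordinal kn))//= indicE mem_set//.
  by rewrite subrr mul0r subr0.
have tn1 n Z : (forall k, ~ F k Z) -> tn n Z = 0.
  by move=> FZ; rewrite /tn big1 ?subrr// => k _; rewrite indicE memNset// subr0.
apply: (@multiplier_lim tn).
- move=> n; apply: multiplierB; first exact: multiplier_cst.
  apply: multiplier_prod => k; apply: multiplierB; first exact: multiplier_cst.
  by have [] := hF k.
- exact: measurable_indic.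
- apply: aeW => Z n.
  have [[k [kn FZ]]|nF] := pselect (exists k, (k < n)%N /\ F k Z).
    by rewrite (tn0 _ _ _ kn FZ) normr1.
  rewrite /tn big1 ?subrr ?normr0// => k _.
  by rewrite indicE memNset ?subr0// => FZ; apply: nF; exists k.
- apply: aeW => Z; rewrite indicE.
  have [[k FZ]|nF] := pselect (exists k, F k Z).
    rewrite mem_set; last by exists k.
    apply: cvg_near_cst; exists k.+1 => // n /= kn; exact: tn0 kn FZ.
  rewrite memNset; last by move=> [k _ FZ]; apply: nF; exists k.
  by apply: cvg_near_cst; apply: nearW => n; apply: tn1 => k FZ; apply: nF; exists k.
Qed.

(** Left open rays generate the Borel sets. For the ray ending at [a], an affine map sends the range
    of [x] into [0, 1] and [a] to 1/2, where the step polynomials apply. *)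
Lemma msets_preimage (x : Amb R p q -> R) (B : set R) : measurable B ->
  measurable_fun setT x -> (exists M, {ae mu, forall Z, `|x Z| <= M}) ->
  multiplier x -> msets (x @^-1` B).
Proof.
move=> mB mx [M xM] hx.
have [s0 sC sU] := sigma_algebra_msets.
have : <<s @RGenInftyO.G R >> `<=` [set B | msets (x @^-1` B)].
  apply: smallest_sub.
    split => [|A hA|A hA] /=.
    - by rewrite preimage_set0.
    - by have := sC _ hA; rewrite !setTD preimage_setC.
    - by rewrite preimage_bigcup; exact: sU.
  move=> _ [a ->] /=.
  (* [L] bounds the modulus of [x - a] almost everywhere; the summand 1 makes it positive. *)
  pose L := `|M| + `|a| + 1.
  have L0 : 0 < L by rewrite ltr_wpDl// addr_ge0.
  have tE y : (2^-1 + (y - a) / (2 * L) < 2^-1) = (y < a).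
    by rewrite -[X in _ < X]addr0 ltrD2l pmulr_llt0 ?invr_gt0 ?mulr_gt0// subr_lt0.
  have t01 y : `|y| <= M -> 0 <= 2^-1 + (y - a) / (2 * L) <= 1.
    move=> yM; have : `|y - a| <= L.
      apply: le_trans (ler_normB _ _) _; rewrite /L.
      by have := ler_norm M; lra.
    rewrite ler_norml => /andP[l1 l2].
    have -> : 2^-1 + (y - a) / (2 * L) = (L + (y - a)) / (2 * L) by field; rewrite gt_eqF.
    rewrite divr_ge0 ?mulr_ge0 ?(ltW L0)//=; last by lra.
    by rewrite ler_pdivrMr ?mulr_gt0//; lra.
  have mE : measurable (x @^-1` `]-oo, a[%classic).
    by rewrite -[X in measurable X]setTI; apply: mx => //; exact: measurable_itv.
  split => //.
  apply: (@multiplier_lim (fun n Z => step_poly n (2^-1 + (x Z - a) / (2 * L)))).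
  - move=> n; apply: multiplierX; apply: multiplierB; first exact: multiplier_cst.
    apply: multiplierX; apply: multiplierD; first exact: multiplier_cst.
    apply: multiplierM (multiplier_cst _); apply: multiplierB => //; exact: multiplier_cst.
  - exact: measurable_indic.
  - apply: filterS xM => Z /t01 h n.
    by have /andP[h1 h2] := step_poly_itv n h; rewrite ger0_norm.
  - apply: filterS xM => Z /t01 h; have := step_poly_cvg h; rewrite tE.
    suff -> : (x Z < a) = (Z \in x @^-1` `]-oo, a[%classic) by rewrite indicE.
    by apply/idP/idP; rewrite inE /= in_itv.
apply; rewrite -(_ : measurable = <<s _>>)//; exact: RGenInftyO.measurableE.
Qed.

Lemma measurable_msets E : measurable E -> msets E.
Proof.
apply: smallest_sub; first exact: sigma_algebra_msets.
move=> _ [i [j [B [mB [->|->]]]]].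
  by have [mx bx] := coord_Re_bounded i j; apply: msets_preimage => //; exact: multiplier_Re.
by have [mx bx] := coord_Im_bounded i j; apply: msets_preimage => //; exact: multiplier_Im.
Qed.

(** Multiplying by the indicator of [E] and testing against the constant 1 gives [w] zero integral
    over every measurable [E]. *)
Lemma annihilator_eq0 w : annihilator w -> {ae mu, forall Z, w Z = 0}.
Proof.
move=> aw; have [mw [M wM] z] := aw.
have wi : mu.-integrable setT (EFin \o w).
  by apply: ae_dominated_integrable wM => //; exact: integrable_cst.
have : ae_eq mu setT (EFin \o w) (cst 0%E).
  apply: integral_ae_eq => // E _ mE.
  have [_ hE] := measurable_msets mE; have [m1 [M1 b1] z1] := hE _ aw.
  rewrite integral0 integral_mkcond.
  transitivity ((\int[mu]_Z (\1_E Z * w Z * test 1 (fun _ _ => 0%N) (fun _ _ => 0%N) Z))%R%:E).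
    rewrite -EFin_Rintegral; last exact: integrable_test b1.
    apply: eq_integral => Z _; rewrite patchE indicE /test !mon0.
    rewrite rmorph1 !mulr1 /=.
    by case: (_ \in _); rewrite ?mul1r ?mul0r.
  by rewrite z1.
by apply: filterS => Z /(_ I) [].
Qed.

End MomentProblem.

(** * Vanishing of the symbol for circular measures on a sphere *)

Section ToeplitzCircular.
Context (R : realType) (p q : nat) (mu : probability (Amb R p q) R) (r : R).
Hypothesis r0 : 0 < r.
Hypothesis sphere : {ae mu, forall Z : Amb R p q,
  \sum_(ij : 'I_p * 'I_q) cabs2 ((Z : 'M[R[i]]_(p, q)) ij.1 ij.2) = r}.
Hypothesis circular : forall v : R[i], `|v| = 1 ->
  forall A : set (Amb R p q), measurable A ->
  mu ((fun Z : Amb R p q => (v ^+ 2 *: (Z : 'M[R[i]]_(p, q)) : Amb R p q)) @^-1` A) = mu A.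

(** The factor [a] treats both parts of [phi] at once: 1 selects the real part and - i the imaginary
    one. *)
Lemma toeplitz_compact_annihilator (phi : Amb R p q -> R[i]) (w : Amb R p q -> R)
    (a : R[i]) :
  Linfty mu phi -> toeplitz_compact mu phi ->
  (forall Z, w Z = complex.Re (a * phi Z)) -> annihilator mu w.
Proof.
move=> phiL phiC wE.
have aphiL : Linfty mu (fun Z => a * phi Z) by apply: LinftyM => //; exact: Linfty_cst.
have [mw bw] := Linfty_Re aphiL.
rewrite (funext wE : w = _); split => // c e1 e2.
pose F c e1 e2 (Z : Amb R p q) := complex.Re (phi Z * (c * mon e1 Z) * Num.conj (mon e2 Z)).
have FL c' f1 f2 : mu.-integrable setT (EFin \o F c' f1 f2).
  have L : Linfty mu (fun Z => phi Z * (c' * mon f1 Z) * Num.conj (mon f2 Z)).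
    apply: LinftyM (LinftyJ (Linfty_mon sphere f2)).
    by apply: LinftyM => //; exact: (Linfty_cmon sphere).
  have [mF [M FM]] := Linfty_Re L.
  by apply: ae_dominated_integrable FM => //; exact: integrable_cst.
have F0 c' f1 f2 : (\int[mu]_Z F c' f1 f2 Z = 0)%R.
  exact: (toeplitz_compact_moment r0 sphere circular).
(* Re u Re x = (Re (u x) + Re (u conj x)) / 2, and conjugating x exchanges the two monomials, so
   both terms are moments. *)
transitivity (2^-1 * (\int[mu]_Z (F (a * c) e1 e2 Z + F (a * Num.conj c) e2 e1 Z))%R).
  rewrite -RintegralZl//; last first.
    by have := integrableD measurableT (FL (a * c) e1 e2) (FL (a * Num.conj c) e2 e1);
      exact: eq_integrable.
  by apply: eq_Rintegral => Z _; rewrite /F /test !reimE; field.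
by rewrite RintegralD// !F0 addr0 mulr0.
Qed.

Lemma toeplitz_compact_eq0 (phi : Amb R p q -> R[i]) :
  Linfty mu phi -> toeplitz_compact mu phi -> {ae mu, forall Z, phi Z = 0}.
Proof.
move=> phiL phiC.
have a1 : annihilator mu (fun Z => complex.Re (phi Z)).
  apply: (toeplitz_compact_annihilator (a := 1) phiL phiC) => Z.
  by rewrite mul1r.
have a2 : annihilator mu (fun Z => complex.Im (phi Z)).
  apply: (toeplitz_compact_annihilator (a := Complex 0 (-1)) phiL phiC) => Z.
  by rewrite ReM /=; ring.
apply: filterS2 (annihilator_eq0 sphere a1) (annihilator_eq0 sphere a2) => Z.
exact: complex_eq0P.
Qed.

End ToeplitzCircular.

(** * The four Cartan types satisfy the sphere and rotation hypotheses *)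

Section ShilovBoundary.
Context (R : realType).

(** In a full rank factorisation E = C B, idempotence cancels to B C = 1, so the trace of E is that
    of an identity matrix of size the rank. *)
Lemma mxtrace_idempotent (F : fieldType) n (E : 'M[F]_n) :
  E *m E = E -> \tr E = (\rank E)%:R.
Proof.
have rect k (C : 'M[F]_(n, k)) (B : 'M[F]_(k, n)) : row_full C -> row_free B ->
    C *m B *m (C *m B) = C *m B -> B *m C = 1%:M.
  move=> fC fB CB; rewrite -[B *m C]mul1mx -[1%:M *m _]mulmx1.
  rewrite -{1}(mulVpmx fC) -(mulmxVp fB).
  transitivity (pinvmx C *m (C *m B *m (C *m B)) *m pinvmx B); first by rewrite !mulmxA.
  by rewrite CB !mulmxA (mulVpmx fC) mul1mx.
move=> EE; rewrite -{1}(mulmx_base E) mxtrace_mulC rect ?mxtrace1//.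
- exact: col_base_full.
- exact: row_base_free.
- by rewrite !mulmx_base.
Qed.

Lemma sum_cabs2_trace p q (Z : 'M[R[i]]_(p, q)) :
  \sum_(ij : 'I_p * 'I_q) cabs2 (Z ij.1 ij.2) = complex.Re (\tr (Z *m cadj Z)).
Proof.
rewrite (big_morph _ (@ReD R) erefl) -(pair_bigA _ (fun i j => cabs2 (Z i j))) /=.
apply: eq_bigr => i _; rewrite mxE (big_morph _ (@ReD R) erefl).
by apply: eq_bigr => j _; rewrite !mxE mulcJ.
Qed.

Lemma cabs2_norm1 (u : R[i]) : `|u| = 1 -> cabs2 u = 1.
Proof.
move=> u1; have := mulcJ u; rewrite -normCK u1 expr1n.
by move=> /(congr1 (@complex.Re R)).
Qed.

Lemma Re_natr n : complex.Re (n%:R : R[i]) = n%:R.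
Proof.
by elim: n => // n IH; rewrite -natr1 ReD IH -[RHS]natr1.
Qed.

(** The sum is the trace of Z Z^*. This product is the identity in types I and III; in type II it is
    idempotent with the rank of Z. Type IV is a direct computation. *)
Lemma shilov_sphere (t : cartan_type) : classical_cartan t ->
  exists2 r : R, 0 < r & forall Z, shilov R t Z ->
    \sum_(ij : 'I_(ct_rows t) * 'I_(ct_cols t)) cabs2 (Z ij.1 ij.2) = r.
Proof.
case: t => [m n [m1 _]|n n2|n n1|n _] /=.
- exists m%:R; first by rewrite ltr0n.
  by move=> Z ZE; rewrite sum_cabs2_trace ZE mxtrace1 Re_natr.
- exists (n./2).*2%:R; first by rewrite ltr0n double_gt0 half_gt0.
  move=> Z [_ [ZZ rk]]; rewrite sum_cabs2_trace mxtrace_idempotent; last first.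
    by rewrite !mulmxA ZZ.
  suff -> : \rank (Z *m cadj Z) = \rank Z by rewrite rk Re_natr.
  apply/eqP; rewrite eqn_leq mxrankM_maxl /=.
  by rewrite -{1}ZZ mxrankM_maxl.
- exists n%:R; first by rewrite ltr0n.
  by move=> Z [_ ZE]; rewrite sum_cabs2_trace ZE mxtrace1 Re_natr.
- exists 1 => // _ [u [x [u1 [x1 ->]]]].
  rewrite -(pair_bigA _ (fun i j => cabs2 ((u *: map_mx _ x) i j))) /= big_ord1 -x1.
  by apply: eq_bigr => j _; rewrite !mxE cabs2M cabs2_norm1// mul1r cabs2_real.
Qed.

Lemma unitary_scalar n (v : R[i]) : `|v| = 1 -> unitary_mx (v%:M : 'M[R[i]]_n).
Proof.
move=> v1; rewrite /unitary_mx /cadj map_scalar_mx tr_scalar_mx -scalar_mxM.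
by rewrite -normCK v1 expr1n.
Qed.

(** In types II and III the scalar matrix [v] acts on both sides of Z, which produces the square;
    types I and IV use [v ^+ 2] directly. *)
Lemma Kgroup_scale (t : cartan_type) (v : R[i]) : `|v| = 1 ->
  Kgroup R t (fun Z => v ^+ 2 *: Z).
Proof.
move=> v1; have v21 : `|v ^+ 2| = 1 by rewrite normrX v1 expr1n.
case: t => [m n|n|n|n] /=.
- exists (v ^+ 2)%:M, 1%:M; split; first exact: unitary_scalar.
  split; first by apply: unitary_scalar; rewrite normr1.
  by apply/funext => Z; rewrite mulmx1 mul_scalar_mx.
- exists v%:M; split; first exact: unitary_scalar.
  by apply/funext => Z; rewrite tr_scalar_mx mul_scalar_mx mul_mx_scalar scalerA.
- exists v%:M; split; first exact: unitary_scalar.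
  by apply/funext => Z; rewrite tr_scalar_mx mul_scalar_mx mul_mx_scalar scalerA.
- exists (v ^+ 2), 1%:M; split => //; split; first by rewrite trmx1 mulmx1.
  split; first by rewrite det1.
  by apply/funext => Z; rewrite map_scalar_mx mulmx1.
Qed.

End ShilovBoundary.

Theorem theorem3p6 (R : realType) (t : cartan_type)
    (mu : probability (Amb R (ct_rows t) (ct_cols t)) R)
    (phi : Amb R (ct_rows t) (ct_cols t) -> R[i]) :
  classical_cartan t ->
  shilov_measure mu ->
  Linfty mu phi ->
  toeplitz_compact mu phi ->
  {ae mu, forall x, phi x = 0}.
Proof.
move=> /(shilov_sphere R)[r r0 rE] [[A [mA [AS muA]]] inv].
apply: (toeplitz_compact_eq0 r0).
- exists (~` A); split; first exact: measurableC.
    by have := probability_setC mu mA; rewrite muA subee.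
  by move=> Z; apply: contra_not => AZ; apply: rE; exact: AS.
- by move=> v v1 B mB; exact: inv (Kgroup_scale t v1) B mB.
Qed.
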